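(* (a) Let $N\subseteq\mathbb{R}^7$ be an (r-oriented) ruled associative 3-fold. Then $\mathbb{R}\times N\subseteq\mathbb{R}\oplus\mathbb{R}^7\cong\mathbb{R}^8$ is an (r-framed) 2-ruled Cayley 4-fold. (b) Let $L\subseteq\mathbb{C}^3$ be an (r-oriented) ruled special Lagrangian 3-fold with phase $-i$. Then $\mathbb{R}\times L\subseteq\mathbb{R}\oplus\mathbb{C}^3\cong\mathbb{R}^7$ is an (r-framed) 2-ruled coassociative 4-fold. (Here the parenthesised adjectives go together: if $N$, respectively $L$, is r-oriented, then the product is r-framed.)
   Context: Write $d\mathbf{x}_{ij\ldots k}=dx_i\wedge\cdots\wedge dx_k$. On $\mathbb{R}^7$ let $$\varphi=d\mathbf{x}_{123}+d\mathbf{x}_{145}+d\mathbf{x}_{167}+d\mathbf{x}_{246}-d\mathbf{x}_{257}-d\mathbf{x}_{347}-d\mathbf{x}_{356},$$ $$\ast\varphi=d\mathbf{x}_{4567}+d\mathbf{x}_{2367}+d\mathbf{x}_{2345}+d\mathbf{x}_{1357}-d\mathbf{x}_{1346}-d\mathbf{x}_{1256}-d\mathbf{x}_{1247},$$ and on $\mathbb{R}^8$ let $$\Phi=d\mathbf{x}_{1234}+d\mathbf{x}_{1256}+d\mathbf{x}_{1278}+d\mathbf{x}_{1357}-d\mathbf{x}_{1368}-d\mathbf{x}_{1458}-d\mathbf{x}_{1467}+d\mathbf{x}_{5678}+d\mathbf{x}_{3478}+d\mathbf{x}_{3456}+d\mathbf{x}_{2468}-d\mathbf{x}_{2457}-d\mathbf{x}_{2367}-d\mathbf{x}_{2358}.$$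 A $k$-dimensional (immersed) submanifold is calibrated by a $k$-form $\eta$ if, for a suitable orientation, $\eta$ restricts to the Riemannian volume form on each tangent space. Associative 3-folds in $\mathbb{R}^7$, coassociative 4-folds in $\mathbb{R}^7$ and Cayley 4-folds in $\mathbb{R}^8$ are the submanifolds calibrated by $\varphi$, $\ast\varphi$ and $\Phi$ respectively. A special Lagrangian 3-fold in $\mathbb{C}^3$ with phase $e^{i\theta}$ is a 3-fold calibrated by $\cos\theta\operatorname{Re}\Omega+\sin\theta\operatorname{Im}\Omega$, where $\Omega=dz_1\wedge dz_2\wedge dz_3$; phase $-i$ thus means calibrated by $-\operatorname{Im}\Omega$. Identifications: $\mathbb{R}\oplus\mathbb{R}^7\cong\mathbb{R}^8$ with $x_1$ the coordinate on $\mathbb{R}$ and the coordinates of $\mathbb{R}^7$ relabelled $(x_2,\ldots,x_8)$; $\mathbb{R}\oplus\mathbb{C}^3\cong\mathbb{R}^7$ with $x_1$ the coordinate on $\mathbb{R}$ and $z_1=x_2+ix_3$, $z_2=x_4+ix_5$, $z_3=x_6+ix_7$. A ruled 3-fold is a 3-dimensional submanifold $N$ with a smooth map $\pi:N\to\Sigma$ to a 2-manifold whose fibres are affine straight lines; an r-orientation is a continuously varying choice of orientation of these lines. A 2-ruled 4-fold is a 4-dimensional submanifold $M$ with a smooth map $\pi:M\to\Sigma$ to a 2-manifold whose fibres are affine 2-planes; an r-framing is a smoothly varying choice of oriented orthonormal basis of these 2-planes.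
   Formalization: The claim ''r-oriented implies r-framed'' is stated only for rulings whose map π is a submersion; for a merely smooth π a continuous r-orientation need not give a smooth r-framing, e.g. π(x,y,z)=(z³, −x sin z + y cos z) on a flat 3-plane. *)

(* Defs.v *)
From HB Require Import structures.
From mathcomp Require Import all_boot all_order all_algebra.
From mathcomp Require Import complex.
From mathcomp Require Import all_classical all_reals all_analysis.

Set Implicit Arguments.
Unset Strict Implicit.
Unset Printing Implicit Defensive.

Import Order.TTheory GRing.Theory Num.Theory.
Import numFieldNormedType.Exports.

Local Open Scope classical_set_scope.
Local Open Scope ring_scope.

(* fwd is only meaningful on dom, and bwd on the coordinate domain cod. *)
Record chart (R : realType) (T : Type) (n : nat) := Chart {
  dom : set T;
  fwd : T -> 'rV[R]_n;
  bwd : 'rV[R]_n -> T }.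

Section Smooth.
Context {R : realType}.

Fixpoint Cr (m n r : nat) (U : set 'rV[R]_m) (f : 'rV[R]_m -> 'rV[R]_n) : Prop :=
  match r with
  | 0 => forall x, U x -> {for x, continuous f}
  | r'.+1 => (forall x, U x -> differentiable f x) /\
             (forall v, Cr r' U (fun x => 'D_v f x))
  end.

(* Only used for open U. *)
Definition smooth_on m n (U : set 'rV[R]_m) (f : 'rV[R]_m -> 'rV[R]_n) : Prop :=
  forall r, Cr r U f.

Definition cod T n (c : chart R T n) : set 'rV[R]_n := fwd c @` dom c.

Definition is_chart (T : topologicalType) n (c : chart R T n) : Prop :=
  [/\ open (dom c), open (cod c),
      forall x, dom c x -> bwd c (fwd c x) = x,
      forall x, dom c x -> {for x, continuous (fwd c)} &
      forall y, cod c y -> {for y, continuous (bwd c)}].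

Definition overlap T n (a b : chart R T n) : set 'rV[R]_n :=
  fwd a @` (dom a `&` dom b).

Definition transition T n (a b : chart R T n) : 'rV[R]_n -> 'rV[R]_n :=
  fwd b \o bwd a.

(* Atlases need not be maximal. *)
Definition smooth_atlas (T : topologicalType) n (A : set (chart R T n)) : Prop :=
  [/\ forall a, A a -> is_chart a,
      forall x, exists2 a, A a & dom a x &
      forall a b, A a -> A b -> smooth_on (overlap a b) (transition a b)].

Definition manifold (T : topologicalType) n (A : set (chart R T n)) : Prop :=
  [/\ hausdorff_space T, @second_countable T & smooth_atlas A].

(* An orientation of (T, A) is given by an atlas of the same smooth structure
   whose transition maps preserve orientation; its charts are the positively
   oriented ones, and need not belong to A. *)
Definition orientation (T : topologicalType) n (A O : set (chart R T n)) : Prop :=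
  [/\ smooth_atlas O, smooth_atlas (A `|` O) &
      forall a b, O a -> O b -> forall y, overlap a b y ->
        0 < \det ('J (transition a b) y)].

Definition smooth_map (T S : topologicalType) m n
    (A : set (chart R T m)) (B : set (chart R S n)) (f : T -> S) : Prop :=
  continuous f /\
  forall a b, A a -> B b ->
    smooth_on (fwd a @` (dom a `&` f @^-1` dom b)) (fwd b \o f \o bwd a).

Definition submersion (T S : topologicalType) m n
    (A : set (chart R T m)) (B : set (chart R S n)) (f : T -> S) : Prop :=
  smooth_map A B f /\
  forall a b, A a -> B b -> forall x, dom a x -> dom b (f x) ->
    row_full ('J (fwd b \o f \o bwd a) (fwd a x)).

Definition smooth_fun (T : Type) k n (A : set (chart R T k))
    (f : T -> 'rV[R]_n) : Prop :=
  forall a, A a -> smooth_on (cod a) (f \o bwd a).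

(* The rows of the matrix are the coordinate vectors of the chart, pushed
   forward by f. *)
Definition coord_frame (T : Type) k n (f : T -> 'rV[R]_n) (a : chart R T k)
    (y : 'rV[R]_k) : 'M[R]_(k, n) := 'J (f \o bwd a) y.

Definition immersed_submanifold (T : topologicalType) k n
    (A : set (chart R T k)) (f : T -> 'rV[R]_n) : Prop :=
  [/\ manifold A, smooth_fun A f &
      forall a, A a -> forall y, cod a y -> row_free (coord_frame f a y)].

End Smooth.

Section Calibrations.
Context {R : realType}.

(* A k-form on R^n with constant coefficients is evaluated on the k rows of a
   matrix. *)
Definition form k n := 'M[R]_(k, n) -> R.

(* If the rows of E are a positively oriented basis of an oriented Euclidean
   k-space, this is its volume form, evaluated on the k vectors whose
   coefficients in E are the rows of c. *)
Definition volume_form k n (E : 'M[R]_(k, n)) (c : 'M[R]_k) : R :=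
  Num.sqrt (\det (E *m E^T)) * \det c.

Definition calibrated (T : topologicalType) k n (eta : form k n)
    (A : set (chart R T k)) (f : T -> 'rV[R]_n) : Prop :=
  immersed_submanifold A f /\
  exists2 O, orientation A O &
    forall a, O a -> forall y, cod a y -> forall c : 'M[R]_k,
      eta (c *m coord_frame f a y) = volume_form (coord_frame f a y) c.

(* dx_{i_1} /\ ... /\ dx_{i_k}, where coordinates are numbered from 1. *)
Definition dx k n (I : k.-tuple nat) : form k n.+1 :=
  fun E => \det (\matrix_(a < k, b < k) E a (inord (tnth I b).-1)).

Definition dx3 n (i j k : nat) : form 3 n.+1 := @dx 3 n [tuple i; j; k].
Definition dx4 n (i j k l : nat) : form 4 n.+1 := @dx 4 n [tuple i; j; k; l].

Definition associative_form : form 3 7 := fun E =>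
  dx3 1 2 3 E + dx3 1 4 5 E + dx3 1 6 7 E + dx3 2 4 6 E
  - dx3 2 5 7 E - dx3 3 4 7 E - dx3 3 5 6 E.

Definition coassociative_form : form 4 7 := fun E =>
  dx4 4 5 6 7 E + dx4 2 3 6 7 E + dx4 2 3 4 5 E + dx4 1 3 5 7 E
  - dx4 1 3 4 6 E - dx4 1 2 5 6 E - dx4 1 2 4 7 E.

Definition Cayley_form : form 4 8 := fun E =>
  dx4 1 2 3 4 E + dx4 1 2 5 6 E + dx4 1 2 7 8 E + dx4 1 3 5 7 E
  - dx4 1 3 6 8 E - dx4 1 4 5 8 E - dx4 1 4 6 7 E
  + dx4 5 6 7 8 E + dx4 3 4 7 8 E + dx4 3 4 5 6 E + dx4 2 4 6 8 E
  - dx4 2 4 5 7 E - dx4 2 3 6 7 E - dx4 2 3 5 8 E.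

(* C^3 is R^6 with z_j = y_(2j-1) + i y_(2j); below j is numbered from 0. *)
Definition dz (v : 'rV[R]_6) (j : 'I_3) : R[i] :=
  (v 0 (inord j.*2) +i* v 0 (inord j.*2.+1))%C.

Definition Omega (E : 'M[R]_(3, 6)) : R[i] :=
  \det (\matrix_(a < 3, j < 3) dz (row a E) j).

(* The phase is e^{i theta}. *)
Definition special_Lagrangian_form (theta : R) : form 3 6 := fun E =>
  cos theta * complex.Re (Omega E) + sin theta * complex.Im (Omega E).

Definition associative_fold (T : topologicalType) (A : set (chart R T 3))
  (f : T -> 'rV[R]_7) : Prop := calibrated associative_form A f.
Definition coassociative_fold (T : topologicalType) (A : set (chart R T 4))
  (f : T -> 'rV[R]_7) : Prop := calibrated coassociative_form A f.
Definition Cayley_fold (T : topologicalType) (A : set (chart R T 4))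
  (f : T -> 'rV[R]_8) : Prop := calibrated Cayley_form A f.
Definition special_Lagrangian_fold (theta : R) (T : topologicalType)
  (A : set (chart R T 3)) (f : T -> 'rV[R]_6) : Prop :=
  calibrated (special_Lagrangian_form theta) A f.

End Calibrations.

Section Rulings.
Context {R : realType}.

Definition orthonormal_rows k n (E : 'M[R]_(k, n)) : Prop := E *m E^T = 1%:M.

Definition affine_plane k n (p : 'rV[R]_n) (E : 'M[R]_(k, n)) : set 'rV[R]_n :=
  [set p + u *m E | u in [set: 'rV[R]_k]].

(* f, assumed continuous, restricts to a homeomorphism from F onto L. *)
Definition homeo_onto (T S : topologicalType) (f : T -> S)
    (F : set T) (L : set S) : Prop :=
  set_bij F L f /\
  exists2 g : S -> T, {within L, continuous g} & forall x, F x -> g (f x) = x.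

(* In the submanifold immersed by f, the subset F is an affine k-plane, and the
   rows of E form an orthonormal basis of its direction. For an embedding f
   this just says that f @` F is an affine plane directed by E. *)
Definition is_plane_framed_by (T : topologicalType) k n (f : T -> 'rV[R]_n)
    (F : set T) (E : 'M[R]_(k, n)) : Prop :=
  orthonormal_rows E /\ exists p, homeo_onto f F (affine_plane p E).

(* With k = 1 on a 3-fold this is a ruling, with k = 2 on a 4-fold a
   2-ruling. *)
Definition ruling k (T S : topologicalType) d n (A : set (chart R T d))
    (f : T -> 'rV[R]_n) (B : set (chart R S 2)) (p : T -> S) : Prop :=
  [/\ manifold B, smooth_map A B p &
      forall s, exists E : 'M[R]_(k, n), is_plane_framed_by f (p @^-1` [set s]) E].

(* An orientation of a line is identified with the unit vector directing it.
   If p is a submersion, v is automatically smooth. It need not be otherwise: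
   on R^3 take p (x, y, z) := (z ^ 3, - x sin z + y cos z). *)
Definition r_orientation (T S : topologicalType) n (f : T -> 'rV[R]_n)
    (p : T -> S) (v : S -> 'rV[R]_n) : Prop :=
  continuous v /\ forall s, is_plane_framed_by f (p @^-1` [set s]) (v s).

(* The ordered basis also fixes the orientation of the plane. *)
Definition r_framing (T S : topologicalType) n (f : T -> 'rV[R]_n)
    (B : set (chart R S 2)) (p : T -> S) (E : S -> 'M[R]_(2, n)) : Prop :=
  (forall i, smooth_fun B (fun s => row i (E s))) /\
  forall s, is_plane_framed_by f (p @^-1` [set s]) (E s).

End Rulings.

Section Products.
Context {R : realType}.

Definition oplus n (t : R) (x : 'rV[R]_n) : 'rV[R]_n.+1 :=
  row_mx (t%:M : 'rV[R]_1) x.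

Definition line_times_chart (T : Type) k (a : chart R T k) :
    chart R (R * T)%type k.+1 :=
  Chart [set q | dom a q.2]
        (fun q => oplus q.1 (fwd a q.2))
        (fun y : 'rV[R]_(1 + k) => (y 0 0, bwd a (rsubmx y))).

Definition line_times_atlas (T : Type) k (A : set (chart R T k)) :
    set (chart R (R * T)%type k.+1) := @line_times_chart T k @` A.

Definition line_times (T : Type) n (f : T -> 'rV[R]_n) (q : R * T) :
    'rV[R]_n.+1 := oplus q.1 (f q.2).

End Products.

(* Main.v *)
(* In charts, the product of an immersion f with the line is
   (t, y) |-> (t, f y), with block-diagonal Jacobian diag(1, J f).  On such a
   frame the Cayley form reduces to the associative form and the coassociative
   form to - Im Omega, because a monomial dx_I vanishes unless I contains the
   new index 1; as both sides are multiples of det c, calibration is inherited.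
   The fibres of p \o snd are the products of the ruling lines with the line.

   The r-framing needs the continuous unit direction v of the ruling to be
   smooth.  Near a point of the submanifold, complete p (in charts) by a
   coordinate of f that is not constant along ker dp; by the inverse function
   theorem this is a local diffeomorphism, whose inverse gives two smooth local
   sections of p at distinct values of that coordinate.  The difference q of
   their images under f is smooth, nonzero and parallel to v, so v = +- q / |q|
   with a sign that is locally constant by continuity of v. *)

Require Import Defs.
From HB Require Import structures.
From mathcomp Require Import all_boot all_order all_algebra.
From mathcomp Require Import complex ring lra.
From mathcomp Require Import all_classical all_reals all_analysis.
Import Order.TTheory GRing.Theory Num.Theory.
Import numFieldNormedType.Exports.
Local Open Scope classical_set_scope.
Local Open Scope ring_scope.

Set Implicit Arguments.
Unset Strict Implicit.
Unset Printing Implicit Defensive.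

(** * Differentials characterised by epsilon estimates *)

Section Differentiability.
Context {R : realType} {V W : normedModType R}.

Lemma differentiable_eps (f : V -> W) (x : V) : differentiable f x ->
  forall e, 0 < e ->
  \forall h \near 0, `|f (h + x) - (f x + 'd f x h)| <= e * `|h|.
Proof.
move=> /diff_locally df e e0; have := (eqaddoP _ _ _ _).1 df e e0.
by apply: filterS => h; rewrite /= !fctE.
Qed.

(** The estimate says that the remainder is [o(h)], and the differential is unique. This converse of
    [differentiable_eps] later computes the differential of a local inverse. *)
Lemma eps_is_diff (f : V -> W) (L : {linear V -> W}) (x : V) :
  continuous L ->
  (forall e, 0 < e ->
   \forall h \near 0, `|f (h + x) - (f x + L h)| <= e * `|h|) ->
  differentiable f x /\ 'd f x = L :> (V -> W).
Proof.
move=> cL Lf.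
have E : f \o shift x = cst (f x) + L +o_ 0 id.
  by apply/eqaddoP => e e0; have := Lf e e0; apply: filterS => h; rewrite /= !fctE.
have dE := diff_unique cL E; split=> //.
by apply/diff_locallyP; rewrite dE.
Qed.

Lemma near_eq_differentiable (f g : V -> W) (x : V) :
  (\near x, f x = g x) -> differentiable f x ->
  differentiable g x /\ 'd g x = 'd f x :> (V -> W).
Proof.
move=> fg df.
have := eps_is_diff (diff_continuous df) (f := g) (x := x).
have fgx := nbhs_singleton fg.
apply => e e0; have := differentiable_eps df e0.
have : \forall h \near 0, f (h + x) = g (h + x).
  by move: fg; rewrite (near_shift 0); apply: filterS => h /=; rewrite subr0.
move=> A B; near=> h; rewrite -fgx -(near A h)//; near: h; exact: B.
Unshelve. all: by end_near. Qed.

End Differentiability.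

(** On a space of matrices a linear map is a finite sum of entries times fixed vectors. *)
Lemma linear_mx_continuous {R : realType} {V : normedModType R} (m n : nat)
  (f : {linear 'M[R]_(m, n) -> V}) : continuous f.
Proof.
have -> : (f : _ -> _) = fun M => \sum_i \sum_j M i j *: f (delta_mx i j).
  apply/funext => M; rewrite [M in LHS]matrix_sum_delta linear_sum.
  by apply: eq_bigr => i _; rewrite linear_sum; apply: eq_bigr => j _; rewrite linearZ.
apply: continuous_big => [|i _]; first exact: add_continuous.
apply: continuous_big => [|j _]; first exact: add_continuous.
move=> M; have cM : N i j @[N --> M] --> M i j by exact: coord_continuous.
exact: (cvgZr_tmp cM).
Qed.
Arguments linear_mx_continuous {R V m n} f.

(** * Calculus of [Ck] maps on subsets of a coordinate space *)

Section Ck.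
Context {R : realType} {m : nat}.
Implicit Types (U : set 'rV[R]_m) (V W : normedModType R).

(* [Cr] for an arbitrary normed codomain, so that it covers scalar functions. *)
Fixpoint Ck V (r : nat) U (f : 'rV[R]_m -> V) : Prop :=
  match r with
  | 0 => forall x, U x -> {for x, continuous f}
  | r'.+1 => (forall x, U x -> differentiable f x) /\
             (forall v, Ck r' U (fun x => 'D_v f x))
  end.

Lemma CrP n r U (f : 'rV[R]_m -> 'rV[R]_n) : Cr r U f <-> Ck r U f.
Proof.
elim: r f => [//|r IH] f /=.
by split=> -[df Df]; split=> // v; apply/IH; exact: Df.
Qed.

Lemma Ck_continuous V r U (f : 'rV[R]_m -> V) x :
  Ck r U f -> U x -> {for x, continuous f}.
Proof.
by case: r => [|r] /=; [exact|move=> [df _] /df; exact: differentiable_continuous].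
Qed.

Lemma CkW V r U (f : 'rV[R]_m -> V) : Ck r.+1 U f -> Ck r U f.
Proof.
elim: r f => [|r IH] f [df Df]; first by move=> x /df/differentiable_continuous.
by split=> // v; apply: IH; exact: Df.
Qed.

Lemma Ck_sub V r U U' (f : 'rV[R]_m -> V) : U' `<=` U -> Ck r U f -> Ck r U' f.
Proof.
move=> UU'; elim: r f => [|r IH] f /=; first by move=> cf x /UU'/cf.
by move=> [df Df]; split=> [x /UU'/df //|v]; exact/IH/Df.
Qed.

(** All conditions in [Ck] are imposed at single points, on a map of the whole space. Smoothness can
    thus be proved with a construction that depends on the point. *)
Lemma Ck_local V r U (f : 'rV[R]_m -> V) :
  (forall x, U x -> exists2 U', U' x & Ck r U' f) -> Ck r U f.
Proof.
elim: r f => [|r IH] f lf /=; first by move=> x /lf[U' U'x]; exact.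
split=> [x /lf[U' U'x [+ _]]|v]; first exact.
by apply: IH => x /lf[U' U'x [_ /(_ v)]]; exists U'.
Qed.

(** Openness turns equality on [U] into equality near each of its points, so the directional
    derivatives agree on [U] as well and the induction continues. *)
Lemma Ck_ext V r U (f g : 'rV[R]_m -> V) : open U ->
  (forall x, U x -> f x = g x) -> Ck r U f -> Ck r U g.
Proof.
move=> oU.
have nearU (h k : 'rV[R]_m -> V) x : (forall x, U x -> h x = k x) -> U x ->
    \forall y \near x, h y = k y.
  move=> hk Ux; have nU : nbhs x U by exact: open_nbhs_nbhs.
  by apply: filterS nU => y /hk.
elim: r f g => [|r IH] f g fg /=.
  move=> cf x Ux; change (g @ x --> g x); rewrite -(fg _ Ux).
  exact: cvg_trans (near_eq_cvg (nearU f g x fg Ux)) (cf x Ux).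
have fgn x : U x -> \forall y \near x, f y = g y by exact: nearU.
move=> [df Df]; split=> [x Ux|v].
  exact: (near_eq_differentiable (fgn x Ux) (df x Ux)).1.
by apply: IH (Df v) => x Ux; apply: near_eq_derive; exact: fgn.
Qed.

Lemma Ck_cst V r U (c : V) : Ck r U (fun=> c).
Proof.
elim: r c => [|r IH] c /=; first by move=> x _; exact: cst_continuous.
split=> [x _|v]; first exact: differentiable_cst.
have -> : (fun x : 'rV[R]_m => 'D_v (fun=> c) x) = (fun=> 0).
  by apply/funext => x; rewrite -[fun=> c]/(cst c) derive_cst.
exact: IH.
Qed.

Lemma Ck_lin V r U (f : {linear 'rV[R]_m -> V}) : Ck r U f.
Proof.
have cf := linear_mx_continuous f.
have df x : differentiable f x by exact: linear_differentiable.
case: r => [|r] /=; first by move=> x _; exact: cf.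
split=> // v.
have -> : (fun x => 'D_v f x) = (fun=> f v).
  by apply/funext => x; rewrite deriveE// diff_lin.
exact: Ck_cst.
Qed.

(** A continuous linear map commutes with ['D_v], so the induction hypothesis applies to
    ['D_v f]. *)
Lemma Ck_linear_comp V W r U (L : {linear V -> W}) (f : 'rV[R]_m -> V) :
  open U -> continuous L -> Ck r U f -> Ck r U (L \o f).
Proof.
move=> oU cL; elim: r f => [|r IH] f /=.
  by move=> cf x Ux; apply: continuous_comp; [exact: cf|exact: cL].
have dL x : differentiable L x by exact: linear_differentiable.
move=> [df Df]; split=> [x /df dfx|v].
  by apply: differentiable_comp.
apply: Ck_ext (IH _ (Df v)) => // x /df dfx /=.
rewrite [RHS]deriveE; last exact: differentiable_comp.
by rewrite diff_comp//= diff_lin// deriveE.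
Qed.

Lemma CkD V r U (f g : 'rV[R]_m -> V) : open U ->
  Ck r U f -> Ck r U g -> Ck r U (fun x => f x + g x).
Proof.
move=> oU; elim: r f g => [|r IH] f g /=.
  by move=> cf cg x Ux; exact: (cvgD (cf x Ux) (cg x Ux)).
move=> [df Df] [dg Dg]; split=> [x Ux|v].
  by apply: differentiableD; [exact: df|exact: dg].
apply: Ck_ext (IH _ _ (Df v) (Dg v)) => // x Ux /=.
by rewrite deriveD//; apply: diff_derivable; [exact: df|exact: dg].
Qed.

Lemma Ck_sum V (I : Type) (s : seq I) (P : pred I) r U (f : I -> 'rV[R]_m -> V) :
  open U -> (forall i, P i -> Ck r U (f i)) ->
  Ck r U (fun x => \sum_(i <- s | P i) f i x).
Proof.
move=> oU Cf; elim: s => [|i s IH].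
  have -> : (fun x => \sum_(i <- [::] | P i) f i x) = fun=> 0.
    by apply/funext => x; rewrite big_nil.
  exact: Ck_cst.
have -> : (fun x => \sum_(j <- i :: s | P j) f j x) = fun x =>
    if P i then f i x + \sum_(j <- s | P j) f j x else \sum_(j <- s | P j) f j x.
  by apply/funext => x; rewrite big_cons.
case Pi: (P i); last exact: IH.
by apply: CkD => //; exact: Cf.
Qed.

(** In the Leibniz rule [f] and [g] also occur undifferentiated; [CkW] lowers their order to
    match. *)
Lemma CkM r U (f g : 'rV[R]_m -> R) : open U ->
  Ck r U f -> Ck r U g -> Ck r U (fun x => f x * g x).
Proof.
move=> oU; elim: r f g => [|r IH] f g.
  by move=> cf cg x Ux; exact: (cvgM (cf x Ux) (cg x Ux)).
move=> Cf Cg; have [df Df] := Cf; have [dg Dg] := Cg; split=> [x Ux|v].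
  by apply: differentiableM; [exact: df|exact: dg].
apply: Ck_ext (CkD oU (IH _ _ (CkW Cf) (Dg v)) (IH _ _ (CkW Cg) (Df v))) => //.
by move=> x Ux /=; rewrite deriveM//; apply: diff_derivable; [exact: df|exact: dg].
Qed.

Lemma Ck_prod (I : Type) (s : seq I) (P : pred I) r U (f : I -> 'rV[R]_m -> R) :
  open U -> (forall i, P i -> Ck r U (f i)) ->
  Ck r U (fun x => \prod_(i <- s | P i) f i x).
Proof.
move=> oU Cf; elim: s => [|i s IH].
  have -> : (fun x => \prod_(i <- [::] | P i) f i x) = fun=> 1.
    by apply/funext => x; rewrite big_nil.
  exact: Ck_cst.
have -> : (fun x => \prod_(j <- i :: s | P j) f j x) = fun x =>
    if P i then f i x * \prod_(j <- s | P j) f j x else \prod_(j <- s | P j) f j x.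
  by apply/funext => x; rewrite big_cons.
case Pi: (P i); last exact: IH.
by apply: CkM => //; exact: Cf.
Qed.

Lemma Ck_det n r U (M : 'rV[R]_m -> 'M[R]_n) : open U ->
  (forall i j, Ck r U (fun x => M x i j)) -> Ck r U (fun x => \det (M x)).
Proof.
move=> oU CM; apply: Ck_sum => // s _; apply: CkM => //; first exact: Ck_cst.
exact: Ck_prod.
Qed.

(** Reduces vector-valued maps to scalar ones, for which products are available. *)
Lemma Ck_rowP n r U (f : 'rV[R]_m -> 'rV[R]_n) : open U ->
  Ck r U f <-> forall i, Ck r U (fun x => f x 0 i).
Proof.
move=> oU; split=> [Cf i|Cf].
  have @L : {linear 'rV[R]_n -> R}.
    by exists (fun N : 'rV[R]_n => N 0 i); do 2![eexists]; do ?[constructor];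
      rewrite ?mxE// => ? *; rewrite ?mxE//; move=> ?; rewrite !mxE.
  by apply: (Ck_linear_comp (L := L) oU _ Cf); exact: coord_continuous.
have -> : f = fun x => \sum_i f x 0 i *: delta_mx 0 i.
  by apply/funext => x; rewrite [LHS]row_sum_delta.
apply: Ck_sum => // i _.
have linL : linear ( *:%R ^~ (delta_mx 0 i) : R -> 'rV[R]_n).
  by move=> u y z; rewrite scalerDl scalerA.
pose L : {linear R -> 'rV[R]_n} := HB.pack ( *:%R ^~ (delta_mx 0 i))
  (GRing.isLinear.Build _ _ _ _ _ linL).
by apply: (Ck_linear_comp (L := L) oU _ (Cf i)); exact: scalel_continuous.
Qed.

(** The derivative of [a ^ (-1/2)] is [- 1/2] times its own cube times the derivative of [a], so the
    induction closes on the function itself. It serves to normalise a vector field. *)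
Lemma Ck_rsqrt r U (a : 'rV[R]_m -> R) : open U -> (forall x, U x -> 0 < a x) ->
  Ck r U a -> Ck r U (fun x => (Num.sqrt (a x))^-1 : R).
Proof.
move=> oU a0.
have DS (t : R) : 0 < t ->
    is_derive t 1 (fun s => (Num.sqrt s)^-1 : R) (- 2^-1 * (Num.sqrt t)^-1 ^+ 3).
  move=> t0; have S0 : Num.sqrt t != 0 by rewrite gt_eqF// sqrtr_gt0.
  have [dt Dt] := is_derive1_sqrt t0.
  apply: DeriveDef; first exact: derivableV.
  rewrite deriveV// Dt /GRing.scale/=; field; exact: S0.
have dS (t : R) : 0 < t -> differentiable (fun s : R => (Num.sqrt s)^-1 : R) t.
  by move=> /DS [dt _]; apply/derivable1_diffP.
elim: r => [|r IH].
  move=> ca x Ux; apply: (@continuous_comp _ _ _ a (fun s => (Num.sqrt s)^-1 : R)).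
    exact: ca.
  exact/differentiable_continuous/dS/a0.
move=> Ca; have [da Da] := Ca; split=> [x Ux|v].
  exact: (differentiable_comp (da x Ux) (dS _ (a0 x Ux))).
(* The cube is written as a product over ['I_3] so that [Ck_prod] applies to it. *)
pose S x : R := (Num.sqrt (a x))^-1; pose c : R := - 2^-1.
apply: (@Ck_ext _ _ _ (fun x => c * (\prod_(i < 3) S x) * 'D_v a x)) => [//|x Ux|];
  last first.
  have CS : Ck r U S := IH (CkW Ca).
  apply: (CkM oU _ (Da v)); apply: CkM => //; first exact: Ck_cst.
  exact: Ck_prod.
rewrite [RHS]deriveE; last first.
  exact: (differentiable_comp (da x Ux) (dS _ (a0 x Ux))).
rewrite (diff_comp (da x Ux) (dS _ (a0 x Ux))) /= diff1E; last exact/dS/a0.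
have [_ Dt] := DS _ (a0 x Ux); rewrite /= derive1E Dt -deriveE; last exact: da.
rewrite prodr_const card_ord /GRing.scale/= /S /c; ring.
Qed.

(** Follows from [Ck_rsqrt] through [1 / a = a * (1 / sqrt (a * a)) ^ 2], which covers both signs of
    [a]. *)
Lemma Ck_inv r U (a : 'rV[R]_m -> R) : open U -> (forall x, U x -> a x != 0) ->
  Ck r U a -> Ck r U (fun x => (a x)^-1).
Proof.
move=> oU a0 Ca; pose s x : R := (Num.sqrt (a x * a x))^-1.
have Cs : Ck r U s.
  apply: Ck_rsqrt => [//|x Ux|]; last exact: CkM.
  by rewrite -expr2 lt_def sqr_ge0 sqrf_eq0 a0.
apply: Ck_ext (CkM oU Ca (CkM oU Cs Cs)) => // x Ux.
rewrite /s -invfM -expr2 sqr_sqrtr -?expr2 ?sqr_ge0// expr2 invfM mulrA.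
by rewrite divff ?mul1r// a0.
Qed.

End Ck.

(** * Composition of [Ck] maps *)

Section CkComp.
Context {R : realType} {m n : nat}.

(** By the chain rule the derivative is the sum of the coordinates of ['D_v f] times the partial
    derivatives of [g] composed with [f]. The latter have one order less, so the induction
    hypothesis applies to them. *)
Lemma Ck_compR r (U : set 'rV[R]_m) (U' : set 'rV[R]_n) (g : 'rV[R]_n -> R)
    (f : 'rV[R]_m -> 'rV[R]_n) :
  open U -> (forall x, U x -> U' (f x)) -> Ck r U f -> Ck r U' g ->
  Ck r U (g \o f).
Proof.
move=> oU fU; elim: r g => [|r IH] g.
  by move=> cf cg x Ux; apply: continuous_comp; [exact: cf|exact/cg/fU].
move=> Cf [dg Dg]; have [df Df] := Cf; split=> [x Ux|v].
  by apply: differentiable_comp; [exact: df|exact/dg/fU].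
apply: (@Ck_ext _ _ _ _ _ (fun x =>
    \sum_i ('D_v f x) 0 i * ('D_(delta_mx 0 i) g \o f) x)) => [//|x Ux|].
  rewrite [RHS]deriveE; last by apply: differentiable_comp; [exact: df|exact/dg/fU].
  have gx := dg _ (fU _ Ux); have fx := df _ Ux.
  rewrite diff_comp//= -(deriveE v fx) [in RHS](row_sum_delta ('D_v f x)).
  by rewrite linear_sum; apply: eq_bigr => i _; rewrite linearZ/= (deriveE _ gx).
apply: Ck_sum => // i _; apply: CkM => //; last by apply: IH; [exact: CkW|exact: Dg].
exact: (Ck_rowP r (fun x => 'D_v f x) oU).1 (Df v) i.
Qed.

Lemma Ck_comp p r (U : set 'rV[R]_m) (U' : set 'rV[R]_n)
    (g : 'rV[R]_n -> 'rV[R]_p) (f : 'rV[R]_m -> 'rV[R]_n) :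
  open U -> open U' -> (forall x, U x -> U' (f x)) -> Ck r U f -> Ck r U' g ->
  Ck r U (g \o f).
Proof.
move=> oU oU' fU Cf Cg; apply/Ck_rowP => // i.
apply: (Ck_compR (g := fun y => g y 0 i) oU fU Cf).
exact: (Ck_rowP r g oU').1 Cg i.
Qed.

End CkComp.

(** * Jacobian matrices, acting on row vectors from the right *)

Section Jacobian.
Context {R : realType} {m n : nat}.

Lemma jacobianP (f : 'rV[R]_m -> 'rV[R]_n) x (M : 'M[R]_(m, n)) :
  is_diff x f (mulmxr M) -> 'J f x = M.
Proof.
move=> fM; apply/row_matrixP => i; rewrite [LHS]rowE /jacobian mul_rV_lin1.
by rewrite diff_val/= -rowE.
Qed.

Lemma is_diff_jacobian (f : 'rV[R]_m -> 'rV[R]_n) x :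
  differentiable f x -> is_diff x f (mulmxr ('J f x)).
Proof.
move=> df; apply: DiffDef => //; apply/funext => v /=.
by rewrite /jacobian mul_rV_lin1.
Qed.

Lemma is_diff_mulmxr (M : 'M[R]_(m, n)) (x : 'rV[R]_m) :
  is_diff x (mulmxr M) (mulmxr M).
Proof.
have cM := linear_mx_continuous (mulmxr M : {linear 'rV[R]_m -> 'rV[R]_n}).
by apply: DiffDef; [exact: linear_differentiable|rewrite diff_lin].
Qed.

End Jacobian.

Lemma Ck_mulmxr {R : realType} (m n p r : nat) (U : set 'rV[R]_m)
    (f : 'rV[R]_m -> 'rV[R]_n) (M : 'M[R]_(n, p)) :
  open U -> Ck r U f -> Ck r U (fun x => f x *m M).
Proof.
move=> oU Cf.
apply: (Ck_linear_comp (L := mulmxr M : {linear 'rV[R]_n -> 'rV[R]_p})) => //.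
exact: linear_mx_continuous.
Qed.

(** * Estimates in the sup norm of matrices *)

Section MatrixNorm.
Context {R : realType}.

Lemma mx_entry_le m n (M : 'M[R]_(m, n)) i j : `|M i j| <= `|M|.
Proof.
rewrite [leRHS]/Num.Def.normr/= mx_normrE.
exact: (le_bigmax _ (fun ij => `|M ij.1 ij.2|) (i, j)).
Qed.

Lemma mx_norm_le m n (M : 'M[R]_(m, n)) e : 0 <= e ->
  (forall i j, `|M i j| <= e) -> `|M| <= e.
Proof.
by move=> e0 Me; rewrite [leLHS]/Num.Def.normr/= mx_normrE; apply: bigmax_le => // -[].
Qed.

(** The factor [n] comes from the sup norm: each entry of the product is a sum of [n] terms. *)
Lemma mulmx_norm_le n p (v : 'rV[R]_n) (M : 'M[R]_(n, p)) :
  `|v *m M| <= n%:R * (`|v| * `|M|).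
Proof.
apply: mx_norm_le => [|i j]; first by rewrite !mulr_ge0.
rewrite mxE (le_trans (ler_norm_sum _ _ _))//.
have -> : n%:R * (`|v| * `|M|) = \sum_(k < n) (`|v| * `|M|).
  by rewrite sumr_const card_ord mulr_natl.
apply: ler_sum => k _.
by rewrite normrM ler_pM// mx_entry_le.
Qed.

End MatrixNorm.

(** * The mean value inequality on a ball *)

Section MeanValue.
Context {R : realType} {n p : nat}.

Lemma Ck_jacobian r (U : set 'rV[R]_n) (f : 'rV[R]_n -> 'rV[R]_p) i j :
  open U -> Ck r.+1 U f -> Ck r U (fun x => 'J f x i j).
Proof.
move=> oU [df Df].
apply: Ck_ext ((Ck_rowP r (fun x => 'D_(delta_mx 0 i) f x) oU).1 (Df _) j) => //.
by move=> x /df dfx; rewrite (deriveEjacobian _ dfx) -rowE mxE.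
Qed.

(** The ball is convex, so the one-variable mean value theorem applies to each coordinate of [f]
    along the segment from [y] to [x]. *)
Lemma mean_value_ball (f : 'rV[R]_n -> 'rV[R]_p) (x0 : 'rV[R]_n) (e K : R) :
  0 <= K ->
  (forall x : 'rV[R]_n, ball x0 e x -> differentiable f x /\ `|'J f x| <= K) ->
  forall x y : 'rV[R]_n, ball x0 e x -> ball x0 e y ->
  `|f x - f y| <= n%:R * (`|x - y| * K).
Proof.
move=> K0 fK x y xe ye; apply: mx_norm_le => [|i j]; first by rewrite !mulr_ge0.
rewrite ord1 {i}; pose d : 'rV[R]_n := x - y; rewrite -/d.
pose g (t : R) : 'rV[R]_n := t *: d + y.
have ge (t : R) : t \in `[0, 1]%R -> ball x0 e (g t).
  rewrite in_itv/= => /andP[t0 t1]; move: xe ye; rewrite -ball_normE /= => xe ye.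
  have -> : x0 - g t = t *: (x0 - x) + (1 - t) *: (x0 - y).
    rewrite /g /d !scalerBr !scalerBl !scale1r.
    by apply/matrixP => a b; rewrite !mxE; ring.
  rewrite (le_lt_trans (ler_normD _ _))// !normrZ ger0_norm// ger0_norm ?subr_ge0//.
  (* The distance to [x0] is bounded by a convex combination of [a] and [b], hence by their maximum,
     which is below [e]. *)
  set a := `|x0 - x| in xe *; set b := `|x0 - y| in ye *.
  have ma : t * a <= t * Num.max a b by rewrite ler_wpM2l// le_max lexx.
  have mb : (1 - t) * b <= (1 - t) * Num.max a b.
    by rewrite ler_wpM2l ?subr_ge0// le_max lexx orbT.
  have : Num.max a b < e by rewrite gt_max xe ye.
  by move: ma mb; lra.
have dg (t : R) : is_diff t g ( *:%R ^~ d).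
  have -> : g = ( *:%R ^~ d) + cst y by [].
  by apply: is_diff_eq; rewrite addr0.
have dfg (t : R) : t \in `[0, 1]%R -> differentiable (f \o g) t.
  by move=> /ge/fK[df _]; apply: differentiable_comp.
pose phi (t : R) : R := f (g t) 0 j.
pose dphi (t : R) : R := (d *m 'J f (g t)) 0 j.
have phiE (t : R) : t \in `[0, 1]%R -> is_derive t 1 phi (dphi t).
  move=> t01; have [df _] := fK _ (ge _ t01).
  have D : derivable (f \o g) t 1 by exact/diff_derivable/dfg.
  apply: DeriveDef.
    exact: (derivable_mxP _ _ _).1 D 0 j.
  have := derive_mx D => /matrixP/(_ 0 j); rewrite [RHS]mxE => <-.
  rewrite (deriveE _ (dfg t t01)) diff_comp//= diff_val scale1r.
  by rewrite /dphi /jacobian mul_rV_lin1.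
have cphi : {within `[0, 1], continuous phi}.
  by apply: derivable_within_continuous => t /phiE[].
have dphi01 (t : R) : t \in `]0, 1[%R -> is_derive t 1 phi (dphi t).
  by move=> /subset_itv_oo_cc; exact: phiE.
have [c c01 phi01] := MVT_segment ler01 dphi01 cphi.
have -> : (f x - f y) 0 j = dphi c.
  move: phi01; rewrite /phi /g scale1r scale0r add0r subrK subr0 mulr1 => <-.
  by rewrite !mxE.
have [_ Jc] := fK _ (ge _ c01).
rewrite (le_trans (mx_entry_le _ _ _))// (le_trans (mulmx_norm_le _ _))//.
by rewrite ler_wpM2l// ler_wpM2l.
Qed.

End MeanValue.

(** Joins completeness and norm on matrix spaces, as the Banach fixed-point theorem requires. *)
HB.instance Definition _ (R : realType) (m n : nat) := Complete.on 'M[R]_(m, n).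

(** * The inverse function theorem *)

Section InverseFunction.
Context {R : realType} {n : nat}.
Variables (U : set 'rV[R]_n) (h : 'rV[R]_n -> 'rV[R]_n) (x0 : 'rV[R]_n).
Hypotheses (oU : open U) (Ux0 : U x0) (Ch : forall r, Ck r U h).
Hypothesis Jx0 : 'J h x0 \in unitmx.

Let B : 'M[R]_n := invmx ('J h x0).
(* The fixed points of x |-> u *m B + G x are the solutions of h x = u. *)
Let G (x : 'rV[R]_n) : 'rV[R]_n := x - h x *m B.

Let diffh x : U x -> differentiable h x.
Proof. by have [dh _] := Ch 1; exact: dh. Qed.

Let diffG x : U x -> differentiable G x /\ 'J G x = 1%:M - 'J h x *m B.
Proof.
move=> /diffh dh.
have dG := is_diffB (is_diff_id x)
  (is_diff_comp (is_diff_jacobian dh) (is_diff_mulmxr B (h x))).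
split; first by case: dG.
apply: jacobianP; apply: (is_diff_eq dG); apply/funext => v.
by rewrite fctE/= mulmxBr mulmx1 mulmxA.
Qed.

(** The Jacobian of [G] is [1 - 'J h x *m B], which vanishes at [x0]. By continuity it is small
    nearby, and the mean value inequality makes [G] a contraction. *)
Lemma local_contraction : exists2 e : R, 0 < e &
  (forall x : 'rV[R]_n, ball x0 e x -> U x /\ 'J h x \in unitmx) /\
  (forall x y : 'rV[R]_n, ball x0 e x -> ball x0 e y ->
    `|G x - G y| <= 2^-1 * `|x - y|).
Proof.
(* Chosen so that [n * K <= 1/2]; the successor keeps the denominator nonzero when [n = 0]. *)
pose K : R := (2 * n.+1%:R)^-1.
have K0 : 0 < K by rewrite invr_gt0 mulr_gt0.
have cdet : {for x0, continuous (fun x => \det ('J h x))}.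
  apply: (Ck_continuous (r := 0)) Ux0; apply: Ck_det => // i j.
  exact: Ck_jacobian.
have cM i j : {for x0, continuous (fun x => (1%:M - 'J h x *m B) i j)}.
  apply: (Ck_continuous (r := 0)) Ux0.
  have -> : (fun x => (1%:M - 'J h x *m B) i j) =
      fun x => (i == j)%:R + \sum_k - B k j * 'J h x i k.
    apply/funext => x; rewrite !mxE -sumrN; congr (_ + _).
    by apply: eq_bigr => k _; rewrite mulNr mulrC.
  apply: CkD => //; first exact: Ck_cst.
  apply: Ck_sum => // k _; apply: CkM => //; first exact: Ck_cst.
  exact: Ck_jacobian.
have nU : \forall x \near x0, U x by exact: open_nbhs_nbhs.
have nD : \forall x \near x0, \det ('J h x) != 0.
  have D0 : \det ('J h x0) != 0 by rewrite -unitfE -unitmxE.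
  exact: (cvgr_neq0 _ cdet D0).
have nMij i j : \forall x \near x0, `|(1%:M - 'J h x *m B) i j| <= K.
  pose M (x : 'rV[R]_n) : R := (1%:M - 'J h x *m B) i j.
  have E0 : M x0 = 0 by rewrite /M mulmxV// subrr mxE.
  have c : M @ x0 --> (0 : R) by rewrite -E0; exact: cM.
  exact: ((cvgr0Pnorm_le _).1 c K K0).

have nM : \forall x \near x0, forall i j, `|(1%:M - 'J h x *m B) i j| <= K.
  have F0 := nbhs_filter x0.
  apply: (filter_forall (F := nbhs x0)) => i.
  apply: (filter_forall (F := nbhs x0)) => j. exact: nMij.
have /nbhs_ballP[e /= e0 eP] : nbhs x0 [set x | [/\ U x, \det ('J h x) != 0 &
    forall i j, `|(1%:M - 'J h x *m B) i j| <= K]].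
  by near=> x; split; near: x.
exists e; first exact: e0.
split=> [x xe|].
  have [Ux Dx _] := eP x xe; split; first exact: Ux.
  by rewrite unitmxE unitfE.
move=> x y xe ye.
have GK (z : 'rV[R]_n) : ball x0 e z -> differentiable G z /\ `|'J G z| <= K.
  move=> /eP[Uz _ Kz]; have [dG ->] := diffG Uz; split=> //.
  by apply: mx_norm_le => //; exact: ltW.
rewrite (le_trans (mean_value_ball (ltW K0) GK xe ye))//.
rewrite mulrCA mulrC ler_wpM2r// /K invfM mulrCA.
by rewrite ler_piMr// ler_pdivrMr// mul1r ler_nat.
Unshelve. all: by end_near. Qed.

(** For each [u] close to [h x0], the Banach theorem on a closed ball gives a fixed point of
    [x |-> u *m B + G x]. Subtracting two fixed-point equations and absorbing the contraction term
    gives the Lipschitz bound. *)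
Lemma local_right_inverse :
  exists (W : set 'rV[R]_n) (Q : 'rV[R]_n -> 'rV[R]_n) (k : R),
  [/\ open W, W (h x0), 0 < k,
    forall u, W u -> [/\ U (Q u), 'J h (Q u) \in unitmx & h (Q u) = u] &
    forall u v, W u -> W v -> `|Q u - Q v| <= k * `|u - v|].
Proof.
have [e e0 [eU eG]] := local_contraction.
pose C : set 'rV[R]_n := closed_ball_ Num.norm x0 (e / 2).
have Ce x : C x -> ball x0 e x.
  rewrite /C /closed_ball_/= -ball_normE/= => /le_lt_trans; apply.
  by rewrite ltr_pdivrMr// ltr_pMr// ltr1n.
(* The radius [e / 4] leaves room for the contraction term, at most [1/2 * (e / 2)], so that the
   closed ball of radius [e / 2] is preserved. *)
pose W : set 'rV[R]_n := [set u | `|(u - h x0) *m B| < e / 4].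
have BE u x : u *m B + G x = x -> h x = u.
  rewrite /G addrCA => /eqP; rewrite -subr_eq0 addrAC subrr add0r subr_eq0 => /eqP uB.
  by rewrite -(mulmxKV Jx0 (h x)) -/B -uB mulmxKV.
have ex_Q u : exists x, W u -> C x /\ h x = u.
  have [Wu|] := pselect (W u); last by exists 0.
  have Cpsi : {homo (fun x => u *m B + G x) : x / C x >-> C x}.
    move=> x Cx; rewrite /C /closed_ball_/=.
    have -> : x0 - (u *m B + G x) = - ((u - h x0) *m B) + (G x0 - G x).
      by rewrite mulmxBl /G; apply/matrixP => a b; rewrite !mxE; ring.
    rewrite (le_trans (ler_normD _ _))// normrN.
    have Gx := eG x0 x (ballxx _ e0) (Ce _ Cx).
    move: Wu Cx Gx; rewrite /W /C /closed_ball_/=; lra.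
  have q0 : 0 <= 2^-1 :> R by rewrite invr_ge0.
  have ctr : is_contraction (mkfun_fun Cpsi).
    exists (NngNum q0); split; first by rewrite /= invf_lt1 ?ltr1n.
    move=> [x y] [/= Cx Cy]; rewrite opprD addrACA subrr add0r.
    by apply: eG; exact: Ce.
  have [||x Cx xE] := banach_fixed_point ctr.
  - exact: closed_closed_ball_.
  - by exists x0; rewrite /C /closed_ball_/= subrr normr0 divr_ge0// ltW.
  by exists x => _; split=> //; apply: BE; rewrite {2}xE.
have [Q QP] := choice ex_Q.
(* The factor 2 absorbs the contraction term; adding 1 makes the constant positive even if [B] has
   norm zero. *)
exists W, Q, (2 * (n%:R * `|B|) + 1); split.
- have cB := linear_mx_continuous (mulmxr B : {linear 'rV[R]_n -> 'rV[R]_n}).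
  have -> : W = (fun u => `|mulmxr B u - h x0 *m B|) @^-1` [set t | t < e / 4].
    by apply/funext => u; rewrite /W/= mulmxBl.
  apply: open_comp; last exact: open_lt.
  by move=> u _; exact: (cvg_norm (cvgB (cB u) (cvg_cst (h x0 *m B)))).
- by rewrite /W/= subrr mul0mx normr0 divr_gt0.
- by rewrite ltr_wpDl// !mulr_ge0.
- by move=> u Wu; have [Cu hu] := QP u Wu; have [] := eU _ (Ce _ Cu).
move=> u v Wu Wv; have [Cu hu] := QP u Wu; have [Cv hv] := QP v Wv.
have E : Q u - Q v = (u - v) *m B + (G (Q u) - G (Q v)).
  by rewrite /G hu hv mulmxBl; apply/matrixP => a b; rewrite !mxE; ring.
have := eG _ _ (Ce _ Cu) (Ce _ Cv).
have := mulmx_norm_le (u - v) B; have := normr_ge0 (u - v).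
have : `|Q u - Q v| <= `|(u - v) *m B| + `|G (Q u) - G (Q v)|.
  by rewrite {1}E ler_normD.
have -> : n%:R * (`|u - v| * `|B|) = (n%:R * `|B|) * `|u - v| by ring.
rewrite mulrDl mul1r -mulrA; lra.
Qed.

(** The Lipschitz bound makes [Q] differentiable, with the inverse of ['J h (Q u)] as its Jacobian.
    By Cramer's rule the entries of that inverse are as regular as [Q], so each order of smoothness
    yields the next. *)
Lemma local_inverse : exists (W : set 'rV[R]_n) (Q : 'rV[R]_n -> 'rV[R]_n),
  [/\ open W, W (h x0), forall u, W u -> U (Q u) /\ h (Q u) = u &
      forall r, Ck r W Q].
Proof.
have [W [Q [k [oW Wh0 k0 QP Qk]]]] := local_right_inverse.
exists W, Q; split=> // [u /QP[]//|].
have dQ u : W u -> differentiable Q u /\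
    'd Q u = mulmxr (invmx ('J h (Q u))) :> ('rV[R]_n -> 'rV[R]_n).
  move=> Wu; have [UQ JQ hQ] := QP u Wu; set N := invmx _.
  have cN := linear_mx_continuous (mulmxr N : {linear 'rV[R]_n -> 'rV[R]_n}).
  apply: (eps_is_diff cN) => e e0.
  (* With this choice [e1 * k * (n * |N|) <= e], which is what the chain of estimates below ends
     with. *)
  pose e1 := e / (k * (n%:R * `|N| + 1)).
  have c0 : 0 < n%:R * `|N| + 1 by rewrite ltr_wpDl// mulr_ge0.
  have e10 : 0 < e1 by rewrite divr_gt0// mulr_gt0.
  have /nbhs_ballP[d /= d0 dP] := differentiable_eps (diffh UQ) e10.
  have nW : \forall v \near (0 : 'rV[R]_n), W (v + u).
    have : \forall v \near u, W v by exact: open_nbhs_nbhs.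
    by rewrite (near_shift 0) => nWu; apply: filterS nWu => v /=; rewrite subr0.
  have nd : \forall v \near (0 : 'rV[R]_n), `|v| < d / k.
    by apply: nbhs0_lt; rewrite divr_gt0.
  near=> v.
  have Wv : W (v + u) by near: v.
  have vd : `|v| < d / k by near: v.
  have [_ _ hQv] := QP _ Wv.
  pose D := Q (v + u) - Q u.
  have Dv : `|D| <= k * `|v| by rewrite (le_trans (Qk _ _ Wv Wu))// addrK.
  have Dd : ball 0 d D.
    rewrite -ball_normE/= sub0r normrN (le_lt_trans Dv)//.
    by rewrite mulrC -ltr_pdivlMr.
  (* The expansion of [h] at [Q u] is applied to the increment [D] of [Q]; its remainder [w],
     multiplied by [- N], is the remainder of [Q]. *)
  have := dP _ Dd; rewrite /D subrK hQv hQ -/D.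
  set w := v + u - _ => we.
  have -> : Q (v + u) - (Q u + mulmxr N v) = - (w *m N).
    have -> : w = v - D *m 'J h (Q u).
      by rewrite /w /jacobian mul_rV_lin1 (addrC u) opprD addrA addrAC addrK.
    by rewrite mulmxBl mulmxK// opprB opprD addrA.
  rewrite normrN (le_trans (mulmx_norm_le _ _))//.
  rewrite mulrCA (le_trans (ler_wpM2r _ we)) ?mulr_ge0//.
  rewrite (le_trans (ler_wpM2r _ (ler_wpM2l (ltW e10) Dv))) ?mulr_ge0//.
  have -> : e1 * (k * `|v|) * (n%:R * `|N|) =
    (e * `|v|) * ((n%:R * `|N|) / (n%:R * `|N| + 1)).
    by rewrite /e1; field; rewrite !gt_eqF.
  apply: ler_piMr; first by rewrite mulr_ge0// ltW.
  by rewrite ler_pdivrMr// mul1r lerDl.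
elim=> [|r IH]; first by move=> u /dQ[/differentiable_continuous].
split=> [u /dQ[]//|v].
apply/Ck_rowP => // j.
pose J u := 'J h (Q u).
have CJ a b : Ck r W (fun u => J u a b).
  apply: (Ck_compR (U' := U) (g := fun x => 'J h x a b) oW _ IH).
    by move=> u /QP[].
  exact: Ck_jacobian oU (Ch r.+1).
(* The entries of the inverse matrix are spelled out as cofactors divided by the determinant. *)
apply: (@Ck_ext _ _ _ _ _ (fun u => \sum_i v 0 i *
   ((\det (J u))^-1 * ((-1) ^+ (j + i) * \det (row' j (col' i (J u))))))) => // [u Wu|].
  have [_ JQ _] := QP u Wu; have [dQu dQE] := dQ u Wu.
  rewrite deriveE// dQE/= mxE; apply: eq_bigr => i _; congr (_ * _).
  by rewrite /invmx JQ mxE [in RHS]mxE.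
apply: Ck_sum => // i _; apply: CkM => //; first exact: Ck_cst.
apply: CkM => //.
  apply: Ck_inv => // [u /QP[_ + _]|]; first by rewrite unitmxE unitfE.
  exact: Ck_det.
apply: CkM => //; first exact: Ck_cst.
apply: Ck_det => // a b.
have -> : (fun u => (row' j (col' i (J u))) a b) = fun u => J u (lift j a) (lift i b).
  by apply/funext => u; rewrite !mxE.
exact: CJ.
Unshelve. all: by end_near. Qed.

End InverseFunction.

(** The left kernel of [A] is a line spanned by [w], and [w *m B] is nonzero, say in column [j]. A
    vector killed by both [A] and this column is a multiple of [w], hence zero. *)
Lemma exists_unitmx_row_mx (F : fieldType) (k n : nat) (A : 'M[F]_(k + 1, k))
    (B : 'M[F]_(k + 1, n)) : row_full A -> row_free B ->
  exists j, row_mx A (col j B) \in unitmx.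
Proof.
move=> fA fB; pose w := nz_row (kermx A).
have rK : \rank (kermx A) = 1%N.
  by rewrite mxrank_ker (eqP fA) addKn.
have w0 : w != 0 by rewrite nz_row_eq0 -mxrank_eq0 rK.
have wB : w *m B != 0 by rewrite mulmx_free_eq0.
have [j wj] : exists j, (w *m B) 0 j != 0.
  apply/existsP; apply: contra_neqT wB => /existsPn wB0.
  by apply/rowP => j; rewrite [RHS]mxE; apply/eqP; rewrite -[_ == _]negbK wB0.
exists j; rewrite -row_free_unit -kermx_eq0; apply/rowV0P => z.
rewrite sub_kermx mul_mx_row => /eqP; rewrite -[0]row_mx0 => /eq_row_mx[zA zB].
have /sub_rVP[c zE] : (z <= w)%MS.
  apply: submx_trans (_ : (kermx A <= w)%MS); first by rewrite sub_kermx zA.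
  have wK : (w <= kermx A)%MS by exact: nz_row_sub.
  by have [_ <-] := mxrank_leqif_sup wK; rewrite rK rank_rV w0.
have := zB; rewrite zE -scalemxAl => /matrixP/(_ 0 0).
rewrite colE mulmxA -colE [LHS]mxE [X in _ * X]mxE [RHS]mxE => /eqP.
by rewrite mulf_eq0 (negPf wj) orbF => /eqP->; rewrite scale0r row_mx0.
Qed.

(** * Pairs of local sections of a submersion *)

Section TransverseSlices.
Context {R : realType} {k n : nat}.
Variables (U : set 'rV[R]_(k + 1)) (g : 'rV[R]_(k + 1) -> 'rV[R]_k).
Variables (F : 'rV[R]_(k + 1) -> 'rV[R]_n) (y0 : 'rV[R]_(k + 1)).
Hypotheses (oU : open U) (Uy0 : U y0).
Hypotheses (Cg : forall r, Ck r U g) (CF : forall r, Ck r U F).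
Hypotheses (gfull : row_full ('J g y0)) (Ffree : row_free ('J F y0)).

(* The two sections come from inverting y |-> (g y, F y 0 j). *)
Lemma transverse_slices :
  exists (j : 'I_n) (W : set 'rV[R]_k) (t : R) (Y0 Y1 : 'rV[R]_k -> 'rV[R]_(k + 1)),
  [/\ open W, W (g y0), 0 < t,
      forall u, W u -> [/\ U (Y0 u), U (Y1 u), g (Y0 u) = u, g (Y1 u) = u &
                       F (Y1 u) 0 j - F (Y0 u) 0 j = t] &
      forall r, Ck r W Y0 /\ Ck r W Y1].
Proof.
have [j Mu] := exists_unitmx_row_mx gfull Ffree.
(* [P] and [L] express [h] as a sum of linear images of [g] and [F], which gives its smoothness and
   its Jacobian. *)
pose P : 'M[R]_(k, k + 1) := row_mx 1%:M 0.
pose L : 'M[R]_(n, k + 1) := row_mx 0 (delta_mx j 0).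
pose h y := g y *m P + F y *m L.
have hE y : h y = row_mx (g y) (col j (F y)).
  by rewrite /h !mul_mx_row !mulmx0 mulmx1 add_row_mx addr0 add0r colE.
have Ch r : Ck r U h by apply: CkD => //; exact: Ck_mulmxr.
have Jh : 'J h y0 \in unitmx.
  suff -> : 'J h y0 = row_mx ('J g y0) (col j ('J F y0)) by [].
  apply: jacobianP.
  have dg := is_diff_jacobian ((Cg 1).1 _ Uy0).
  have dF := is_diff_jacobian ((CF 1).1 _ Uy0).
  have dgP := is_diff_comp dg (is_diff_mulmxr P (g y0)).
  have dFL := is_diff_comp dF (is_diff_mulmxr L (F y0)).
  apply: (is_diff_eq (is_diffD dgP dFL)); apply/funext => z.
  rewrite fctE/= -!mulmxA -mulmxDr; congr (_ *m _).
  by rewrite !mul_mx_row !mulmx0 mulmx1 add_row_mx addr0 add0r colE.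
have [W [Q [oW Wh QP CQ]]] := local_inverse oU Uy0 Ch Jh.
pose s (t : R) (u : 'rV[R]_k) : 'rV[R]_(k + 1) := u *m P + row_mx 0 t%:M.
have sE t u : s t u = row_mx u t%:M.
  by rewrite /s mul_mx_row mulmx0 mulmx1 add_row_mx addr0 add0r.
have Cs t r V : open V -> Ck r V (s t).
  move=> oV; apply: CkD => //; last exact: Ck_cst.
  exact: (Ck_lin r V (mulmxr P : {linear 'rV[R]_k -> 'rV[R]_(k + 1)})).
pose t0 := F y0 0 j.
have hs : h y0 = s t0 (g y0).
  rewrite hE sE; congr row_mx; apply/matrixP => a b; rewrite !ord1 !mxE.
  by rewrite eqxx.
(* [W] is open and contains [s t0 (g y0)], so the last coordinate can be raised slightly. *)
have [t t_gt0 Wt] : exists2 t : R, 0 < t & W (s (t0 + t) (g y0)).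
  have cs : {for 0, continuous (fun t => s (t0 + t) (g y0))}.
    have -> : (fun t => s (t0 + t) (g y0)) =
        (fun t => s t0 (g y0) + t *: row_mx 0 1%:M).
      apply/funext => t; rewrite !sE scale_row_mx scaler0 add_row_mx addr0.
      by rewrite scale_scalar_mx mulr1 raddfD.
    apply: cvgD; first exact: cvg_cst.
    exact: scalel_continuous.
  have : \forall t \near (0 : R), W (s (t0 + t) (g y0)).
    by apply: cs; rewrite addr0 -hs; exact: open_nbhs_nbhs.
  move=> /nbhs_ballP[e /= e0 eW]; exists (e / 2); first by rewrite divr_gt0.
  apply: eW; rewrite -ball_normE/= sub0r normrN gtr0_norm ?divr_gt0//.
  by rewrite ltr_pdivrMr// ltr_pMr// ltr1n.
pose W' : set 'rV[R]_k := (s t0 @^-1` W) `&` (s (t0 + t) @^-1` W).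
have os c : open (s c @^-1` W).
  by apply: open_comp => // u _; apply: (Ck_continuous (Cs c 0%N setT openT)).
have oW' : open W' by exact: openI.
have hQ c u : W (s c u) ->
    [/\ U (Q (s c u)), g (Q (s c u)) = u & F (Q (s c u)) 0 j = c].
  move=> /QP[UQ hQ0].
  have : row_mx (g (Q (s c u))) (col j (F (Q (s c u)))) = row_mx u c%:M.
    by rewrite -hE hQ0 sE.
  move=> /eq_row_mx[gE FE]; split=> //.
  by move/matrixP : FE => /(_ 0 0); rewrite !mxE eqxx.
exists j, W', t, (Q \o s t0), (Q \o s (t0 + t)); split=> //.
- by split=> //=; rewrite -hs.
- move=> u [/hQ[U0 g0 F0] /hQ[U1 g1 F1]]; split=> //=.
  by rewrite F0 F1 addrAC subrr add0r.
- by move=> r; split; apply: (Ck_comp oW' oW _ (Cs _ r _ oW') (CQ r)) => u [].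
Qed.

End TransverseSlices.

(** * Open sets in charts, and smoothness of a continuous ruling direction *)

Section ChartImages.
Context {R : realType} {T : topologicalType} {k : nat}.
Implicit Types (a b : chart R T k) (D : set T).

Lemma fwd_imageE a D : is_chart a ->
  fwd a @` (dom a `&` D) = cod a `&` bwd a @^-1` D.
Proof.
move=> [_ _ aK _ _]; apply/seteqP; split=> [_ [x [ax Dx] <-]|_ [[x ax <-]]] /=.
  by rewrite aK//; split=> //; exists x.
by rewrite aK// => Dx; exists x.
Qed.

Lemma open_fwd_image a D : is_chart a -> open D -> open (fwd a @` (dom a `&` D)).
Proof.
move=> ca oD; have [_ oa _ _ cb] := ca; rewrite fwd_imageE// openE => y [ay Dy].
rewrite /interior; apply: filterI; first exact: open_nbhs_nbhs.
by apply: (cb y ay); exact: open_nbhs_nbhs.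
Qed.

End ChartImages.

Lemma continuous_direction_smooth {R : realType} (N S : topologicalType) (k n : nat)
    (A : set (chart R N (k + 1))) (B : set (chart R S k)) (f : N -> 'rV[R]_n)
    (p : N -> S) (v : S -> 'rV[R]_n) :
  immersed_submanifold A f -> manifold B -> submersion A B p ->
  r_orientation f p v -> smooth_fun B v.
Proof.
move=> [[_ _ [chA covA _]] sf imf] [_ _ [chB _ _]] [[cp sp] subp] [cv frv].
move=> b Bb r; apply/CrP; apply: Ck_local => _ [s0 bs0 <-]; set u0 := fwd b s0.
have [ob ocb bK cfb cbb] := chB _ Bb.
(* The fibre over [s0] is nonempty because it maps onto a line; the parameter 0 gives a point of
   that line. *)
have [x0 px0] : exists x0, p x0 = s0.
  have [_ [q [[_ _ sur] _]]] := frv s0.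
  have [|x px _] := sur q; last by exists x.
  by exists 0 => //; rewrite mul0mx addr0.
have [a Aa ax0] := covA x0; have [oa oca aK cfa cba] := chA _ Aa.
pose U := fwd a @` (dom a `&` p @^-1` dom b).
have UE : U = cod a `&` bwd a @^-1` (p @^-1` dom b) by exact/fwd_imageE/chA.
have oU : open U.
  apply: open_fwd_image; first exact: chA.
  by apply: open_comp => // x _; exact: cp.
have Ux0 : U (fwd a x0) by exists x0 => //; split=> //=; rewrite px0.
pose g := fwd b \o p \o bwd a; pose F := f \o bwd a.
have Cg i : Ck i U g by apply/CrP; exact: sp.
have CF i : Ck i U F.
  by apply: (Ck_sub _ ((CrP _ _ _).1 (sf _ Aa i))); rewrite UE => y [].
have gf : row_full ('J g (fwd a x0)) by apply: subp => //; rewrite px0.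
have Ff : row_free ('J F (fwd a x0)) by apply: imf => //; exists x0.
have [j [W [t [Y0 [Y1 [oW Wu0 t0 YP CY]]]]]] := transverse_slices oU Ux0 Cg CF gf Ff.
have gx0 : g (fwd a x0) = u0 by rewrite /g/= aK// px0.
rewrite gx0 in Wu0.
pose q u := F (Y1 u) - F (Y0 u).
have Cq i : Ck i W q.
  have [C0 C1] := CY i.
  apply: CkD => //; first by apply: (Ck_comp oW oU _ C1 (CF i)) => u /YP[].
  rewrite (_ : (fun x => _) = fun x => F (Y0 x) *m (- 1%:M)); last first.
    by apply/funext => x; rewrite mulmxN mulmx1.
  apply: Ck_mulmxr => //.
  by apply: (Ck_comp oW oU _ C0 (CF i)) => u /YP[].
(* [Y0 u] and [Y1 u] lie in one fibre, so [q u] joins two points of a line directed by [v]. Its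
   coordinate [j] is [t]. *)
have qv u : W u -> exists2 tau, q u = tau *: v (bwd b u) & tau * v (bwd b u) 0 j = t.
  move=> Wu; have [U0 U1 g0 g1 FE] := YP u Wu.
  have fib y : U y -> g y = u -> p (bwd a y) = bwd b u.
    by rewrite UE => -[_ /= pb] <-; rewrite /g/= bK.
  have [_ [c [[hom _ _] _]]] := frv (bwd b u).
  have [c0 _ c0E] := hom _ (fib _ U0 g0); have [c1 _ c1E] := hom _ (fib _ U1 g1).
  have qE : q u = ((c1 - c0) 0 0) *: v (bwd b u).
    rewrite /q /F/= -c0E -c1E opprD addrACA subrr add0r -mulmxBl.
    by rewrite {1}[c1 - c0]mx11_scalar mul_scalar_mx.
  exists ((c1 - c0) 0 0) => //.
  have : q u 0 j = t by rewrite /q mxE [X in _ + X]mxE.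
  by rewrite qE mxE.
(* Since [tau * kap u = t > 0], the sign of [tau] is that of [kap u]. This is fixed on a
   neighbourhood of [u0], where continuity keeps [kap u * kap u0] positive. *)
pose kap u := v (bwd b u) 0 j.
have kap0 : kap u0 != 0.
  have [tau _ tk] := qv _ Wu0; apply: contraTneq t0 => k0.
  by rewrite -tk -/(kap u0) k0 mulr0 ltxx.
have ckap : {for u0, continuous kap}.
  apply: (@continuous_comp _ _ _ (v \o bwd b) (fun w : 'rV[R]_n => w 0 j)).
    by apply: continuous_comp; [apply: cbb; exists s0|exact: cv].
  exact: coord_continuous.
pose W1 := W `&` [set u | 0 < kap u * kap u0].
have nW1 : nbhs u0 W1.
  apply: filterI; first exact: open_nbhs_nbhs.
  have c2 : {for u0, continuous (fun u => kap u * kap u0)}.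
    exact: cvgM ckap (cvg_cst _).
  by apply: (cvgr_gt _ c2); rewrite -expr2 lt_def sqr_ge0 sqrf_eq0 kap0.
exists (W1°); first exact: nW1.
have W1W : W1° `<=` W by move=> u /interior_subset[].
have oW1 : open W1° by exact: open_interior.
(* The squared Euclidean length of [q u], equal to [tau ^+ 2] because [v] has unit length. *)
pose a2 u := \sum_i q u 0 i * q u 0 i.
have Cqi i l : Ck l W1° (fun u => q u 0 i).
  by apply: Ck_sub W1W _; exact: (Ck_rowP l q oW).1 (Cq l) i.
have a2E u tau : q u = tau *: v (bwd b u) -> a2 u = tau ^+ 2.
  move=> qE; have [on _] := frv (bwd b u).
  have : (q u *m (q u)^T) 0 0 = tau ^+ 2.
    rewrite qE linearZ/= -scalemxAl -scalemxAr on scalerA mxE mxE eqxx mulr1.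
    by rewrite expr2.
  by rewrite mxE => <-; apply: eq_bigr => i _; rewrite [(q u)^T i 0]mxE.
have tau0 u tau : W u -> q u = tau *: v (bwd b u) -> tau != 0.
  move=> Wu qE; have [_ _ _ _ FE] := YP u Wu.
  apply: contraTneq t0 => tau0; rewrite -FE.
  have : q u 0 j = 0 by rewrite qE tau0 scale0r mxE.
  by rewrite /q mxE [X in _ + X]mxE => ->; rewrite ltxx.
have a20 u : W1° u -> 0 < a2 u.
  move=> /W1W Wu; have [tau qE _] := qv u Wu.
  by rewrite (a2E _ _ qE) lt_def sqr_ge0 sqrf_eq0 (tau0 _ _ Wu qE).
have Ca2 l : Ck l W1° a2 by apply: Ck_sum => // i _; exact: CkM.
apply/Ck_rowP => // i.
apply: (@Ck_ext _ _ _ _ _ (fun u =>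
    Num.sg (kap u0) * ((Num.sqrt (a2 u))^-1 * q u 0 i) : R)) => //.
  move=> u W1u; have [Wu ku] := interior_subset W1u; have [tau qE tk] := qv u Wu.
  have taun0 := tau0 _ _ Wu qE.
  rewrite (a2E _ _ qE) sqrtr_sqr qE mxE /=.
  have sgk : Num.sg (kap u0) = Num.sg tau.
    have : 0 < tau * kap u0.
      have ku0 : 0 < kap u ^+ 2.
        rewrite lt_def sqr_ge0 sqrf_eq0 andbT; apply: contraTneq ku => ->.
        by rewrite mul0r ltxx.
      have E : kap u ^+ 2 * (tau * kap u0) = t * (kap u * kap u0).
        by rewrite -(tk : tau * kap u = t); ring.
      by rewrite -(pmulr_rgt0 _ ku0) E mulr_gt0.
    have [tn|tp|] := ltgtP tau 0; last by move/eqP; rewrite (negPf taun0).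
      by rewrite nmulr_rgt0// => kn; rewrite !ltr0_sg.
    by rewrite pmulr_rgt0// => kp; rewrite !gtr0_sg.
  rewrite sgk !mulrA -[RHS]mul1r; congr (_ * _).
  have [tn|tp|] := ltgtP tau 0; last by move/eqP; rewrite (negPf taun0).
    by rewrite ltr0_sg// ltr0_norm// invrN mulrNN mul1r mulVf.
  by rewrite gtr0_sg// gtr0_norm// mul1r mulVf.
have CS : Ck r W1° (fun u => (Num.sqrt (a2 u))^-1 : R) by exact: Ck_rsqrt.
by apply: CkM => //; [exact: Ck_cst|exact: CkM].
Qed.

(** * Separation and countability for products with the line *)

Section ProductTopology.

Lemma prod_hausdorff (T S : topologicalType) :
  hausdorff_space T -> hausdorff_space S -> hausdorff_space (T * S)%type.
Proof.
move=> hT hS [x1 y1] [x2 y2] cl; congr pair.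
- apply: hT => A B nA nB.
  have [||[a b] [/= Aa Ba]] := cl (fst @^-1` A) (fst @^-1` B).
  + exact: (@cvg_fst _ _ (nbhs x1) (nbhs y1)).
  + exact: (@cvg_fst _ _ (nbhs x2) (nbhs y2)).
  by exists a.
- apply: hS => A B nA nB.
  have [||[a b] [/= Aa Ba]] := cl (snd @^-1` A) (snd @^-1` B).
  + exact: (@cvg_snd _ _ (nbhs x1) (nbhs y1)).
  + exact: (@cvg_snd _ _ (nbhs x2) (nbhs y2)).
  by exists b.
Qed.

Lemma prod_second_countable (T S : topologicalType) :
  @second_countable T -> @second_countable S -> @second_countable (T * S)%type.
Proof.
move=> [B1 cB1 [oB1 bB1]] [B2 cB2 [oB2 bB2]].
exists ((fun UV => UV.1 `*` UV.2) @` (B1 `*` B2)).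
  by apply: card_le_trans (card_image_le _ _) _; exact: countableX.
split=> [_ [[U V] /= [BU BV] <-]|[x y] A [[U V] /= [nU nV] UVA]].
  rewrite openE => -[a b] [/= Ua Vb]; exists (U, V) => //=.
  by split; apply: open_nbhs_nbhs; split=> //; [exact: oB1|exact: oB2].
have [U' [BU' U'x] U'U] := bB1 x _ nU; have [V' [BV' V'y] V'V] := bB2 y _ nV.
exists (U' `*` V'); first by split=> //; exists (U', V').
by move=> [a b] [/= /U'U Ua /V'V Vb]; exact: UVA.
Qed.

(** Balls with rational centre and radius form a countable base. *)
Lemma real_second_countable (R : realType) : @second_countable R.
Proof.
exists (range (fun cr : rat * rat => ball (ratr cr.1 : R) (ratr cr.2))).
  by apply: card_le_trans (card_image_le _ _) _; exact: countableP.
split=> [_ [cr _ <-]|x A /=]; first exact: ball_open.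
rewrite nbhsE => -[V [oV Vx] VA].
have [c [r /= [xB BV]]] := open_subball_rat oV (mem_set Vx).
exists (ball (ratr c : R) (ratr r)); last exact: subset_trans VA.
by split; [exists (c, r)|exact: set_mem].
Qed.

End ProductTopology.

(** * The product of a map with the identity of the line, in coordinates *)

Section Suspension.
Context {R : realType}.

Definition suspend k n (g : 'rV[R]_k -> 'rV[R]_n) (y : 'rV[R]_(1 + k)) :
  'rV[R]_(1 + n) := row_mx (lsubmx y) (g (rsubmx y)).

Lemma lsubmxE k (y : 'rV[R]_(1 + k)) : lsubmx y = (y 0 0)%:M.
Proof.
apply/matrixP => a b; rewrite !ord1 !mxE eqxx mulr1n.
by congr (y _ _); apply/val_inj.
Qed.

Lemma rsubmx_oplus k t (x : 'rV[R]_k) : rsubmx (oplus t x : 'rV[R]_(1 + k)) = x.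
Proof. exact: row_mxKr. Qed.

Lemma oplus00 k t (x : 'rV[R]_k) : oplus t x 0 0 = t.
Proof.
have := lsubmxE (oplus t x); rewrite row_mxKl => /matrixP/(_ 0 0).
by rewrite !mxE !eqxx !mulr1n.
Qed.

Lemma oplusK k (y : 'rV[R]_(1 + k)) : oplus (y 0 0) (rsubmx y) = y.
Proof. by rewrite /oplus -lsubmxE hsubmxK. Qed.

Lemma suspendE k n (g : 'rV[R]_k -> 'rV[R]_n) y :
  suspend g y = oplus (y 0 0) (g (rsubmx y)).
Proof. by rewrite /suspend lsubmxE. Qed.

(** [lP] keeps only the line coordinate, [rP] drops it, and [iP] inserts a zero in its place. They
    write [suspend g] through linear maps, so that the sum and chain rules apply. *)
Let lP k n : 'M[R]_(1 + k, 1 + n) := block_mx 1%:M 0 0 0.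
Let iP n : 'M[R]_(n, 1 + n) := row_mx 0 1%:M.
Let rP k : 'M[R]_(1 + k, k) := col_mx 0 1%:M.

Let rPE k (y : 'rV[R]_(1 + k)) : rsubmx y = y *m rP k.
Proof. by rewrite -{2}[y]hsubmxK mul_row_col mulmx0 mulmx1 add0r. Qed.

Let suspend_mulmx k n (g : 'rV[R]_k -> 'rV[R]_n) :
  suspend g = fun y => y *m lP k n + g (y *m rP k) *m iP n.
Proof.
apply/funext => y; rewrite -rPE -{2}[y]hsubmxK mul_row_block !mulmx0 !addr0 mulmx1.
by rewrite mul_mx_row mulmx0 mulmx1 add_row_mx addr0 add0r.
Qed.

Lemma Ck_comp_rsubmx k n r (U : set 'rV[R]_k) (g : 'rV[R]_k -> 'rV[R]_n) :
  open U -> Ck r U g ->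
  Ck r ((rsubmx : 'rV[R]_(1 + k) -> 'rV[R]_k) @^-1` U) (g \o rsubmx).
Proof.
move=> oU Cg.
have -> : (rsubmx : 'rV[R]_(1 + k) -> 'rV[R]_k) = mulmxr (rP k).
  by apply/funext => y; rewrite rPE.
have oP : open (mulmxr (rP k) @^-1` U : set 'rV[R]_(1 + k)).
  by apply: open_comp => // y _; exact: linear_mx_continuous.
by apply: (Ck_comp oP oU) => //; exact: Ck_lin.
Qed.

Lemma open_rsubmx k (U : set 'rV[R]_k) : open U ->
  open ((rsubmx : 'rV[R]_(1 + k) -> 'rV[R]_k) @^-1` U).
Proof. by move=> oU; apply: open_comp => // y _; exact: continuous_rsubmx. Qed.

Lemma Ck_suspend k n r (U : set 'rV[R]_k) (g : 'rV[R]_k -> 'rV[R]_n) :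
  open U -> Ck r U g ->
  Ck r ((rsubmx : 'rV[R]_(1 + k) -> 'rV[R]_k) @^-1` U) (suspend g).
Proof.
move=> oU Cg; have oP := open_rsubmx oU; rewrite suspend_mulmx; apply: CkD => //.
  exact: (Ck_lin _ _ (mulmxr (lP k n) : {linear 'rV[R]_(1 + k) -> 'rV[R]_(1 + n)})).
apply: Ck_mulmxr => //.
have -> : (fun y => g (y *m rP k)) = g \o rsubmx by apply/funext => y /=; rewrite rPE.
exact: Ck_comp_rsubmx.
Qed.

Lemma jacobian_suspend k n (g : 'rV[R]_k -> 'rV[R]_n) y :
  differentiable g (rsubmx y) ->
  'J (suspend g) y = block_mx 1%:M 0 0 ('J g (rsubmx y)).
Proof.
move=> dg; apply: jacobianP.
have dl := is_diff_mulmxr (lP k n) y; have dr := is_diff_mulmxr (rP k) y.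
have dg' : is_diff (mulmxr (rP k) y) g (mulmxr ('J g (rsubmx y))).
  by rewrite /= -rPE; exact: is_diff_jacobian.
have di := is_diff_mulmxr (iP n) ((g \o mulmxr (rP k)) y).
have ds := is_diffD dl (is_diff_comp (is_diff_comp dr dg') di).
rewrite suspend_mulmx; apply: (is_diff_eq ds); apply/funext => z.
rewrite fctE/= -!mulmxA -mulmxDr; congr (_ *m _).
rewrite mul_mx_row mulmx0 mulmx1 mul_col_mx mul0mx mul1mx.
have -> : col_mx 0 (row_mx 0 ('J g (rsubmx y))) = block_mx 0 0 0 ('J g (rsubmx y))
    :> 'M[R]_(1 + k, 1 + n) by rewrite /block_mx row_mx0.
by rewrite add_block_mx !addr0 !add0r.
Qed.

Lemma det_diag1 k (M : 'M[R]_k) :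
  \det (block_mx 1%:M 0 0 M : 'M[R]_(1 + k)) = \det M.
Proof. by rewrite det_ublock det1 mul1r. Qed.

Lemma mulmx_tr_diag1 k n (E : 'M[R]_(k, n)) :
  let D : 'M[R]_(1 + k, 1 + n) := block_mx 1%:M 0 0 E in
  D *m D^T = block_mx 1%:M 0 0 (E *m E^T).
Proof.
rewrite /= tr_block_mx mulmx_block !trmx0 trmx1 !mulmx0 !mul0mx !mulmx1.
by rewrite !addr0 !add0r.
Qed.

Lemma row_free_diag1 k n (E : 'M[R]_(k, n)) : row_free E ->
  row_free (block_mx 1%:M 0 0 E : 'M[R]_(1 + k, 1 + n)).
Proof. by move=> fE; rewrite /row_free rank_diag_block_mx mxrank1 (eqP fE). Qed.

End Suspension.

(** * Charts, orientations, immersions and calibrations on the product *)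

Section LineCharts.
Context {R : realType} {T : topologicalType} {k : nat}.
Implicit Types (a b : chart R T k) (D : set T).

Lemma line_fwd_image a D : fwd (line_times_chart a) @` [set q | D q.2] =
  (rsubmx : 'rV[R]_(1 + k) -> 'rV[R]_k) @^-1` (fwd a @` D).
Proof.
apply/seteqP; split=> [_ [[t x] /= Dx <-]|y [x Dx /= xy]].
  by rewrite /preimage/= rsubmx_oplus; exists x.
by exists (y 0 0, x) => //=; rewrite xy oplusK.
Qed.

Lemma line_cod a : cod (line_times_chart a) =
  (rsubmx : 'rV[R]_(1 + k) -> 'rV[R]_k) @^-1` cod a.
Proof. exact: line_fwd_image. Qed.

Lemma line_overlap a b : overlap (line_times_chart a) (line_times_chart b) =
  (rsubmx : 'rV[R]_(1 + k) -> 'rV[R]_k) @^-1` overlap a b.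
Proof. exact: (line_fwd_image a (dom a `&` dom b)). Qed.

Lemma line_transition a b :
  transition (line_times_chart a) (line_times_chart b) = suspend (transition a b).
Proof. by apply/funext => y; rewrite suspendE. Qed.

Lemma line_times_bwd n (f : T -> 'rV[R]_n) a :
  line_times f \o bwd (line_times_chart a) = suspend (f \o bwd a).
Proof. by apply/funext => y; rewrite suspendE. Qed.

Lemma oplus_continuous n : continuous (fun q : R * 'rV[R]_n => oplus q.1 q.2).
Proof.
have -> : (fun q : R * 'rV[R]_n => oplus q.1 q.2) =
    fun q => q.1 *: row_mx (1%:M : 'rV[R]_1) 0
             + mulmxr (row_mx (0 : 'M[R]_(n, 1)) 1%:M) q.2.
  apply/funext => -[t x]; rewrite /= mul_mx_row mulmx0 mulmx1 scale_row_mx scaler0.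
  by rewrite add_row_mx addr0 add0r scale_scalar_mx mulr1.
move=> [t x].
have c1 : q.1 @[q --> (t, x)] --> t by exact: cvg_fst.
pose M : 'M[R]_(n, 1 + n) := row_mx 0 1%:M.
have c2 : mulmxr M q.2 @[q --> (t, x)] --> mulmxr M x.
  apply: (@cvg_comp _ _ _ snd (mulmxr M : 'rV[R]_n -> _)); first exact: cvg_snd.
  exact: linear_mx_continuous.
exact: cvgD (cvgZr_tmp c1) c2.
Qed.

Lemma line_is_chart a : is_chart a -> is_chart (line_times_chart a).
Proof.
move=> [oa oca aK cf cb]; split.
- exact: (open_comp (fun q _ => cvg_snd)).
- by rewrite line_cod; exact: open_rsubmx.
- by move=> [t x] /= /aK ax; rewrite oplus00 rsubmx_oplus ax.
- move=> [t x] /= ax.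
  apply: (@continuous_comp _ _ _ (fun q : R * T => (q.1, fwd a q.2))
    (fun q : R * 'rV[R]_k => oplus q.1 q.2)); last exact: oplus_continuous.
  have c1 : q.1 @[q --> (t, x)] --> t by exact: cvg_fst.
  have c2 : fwd a q.2 @[q --> (t, x)] --> fwd a x.
    by apply: (@cvg_comp _ _ _ snd (fwd a)); [exact: cvg_snd|exact: cf].
  exact: (cvg_pair c1 c2).
- move=> y; rewrite line_cod => ay.
  have c1 : (fun z : 'rV[R]_(1 + k) => z 0 0) @ y --> y 0 0 by exact: coord_continuous.
  have c2 : bwd a (rsubmx (z : 'rV[R]_(1 + k))) @[z --> y] -->
      bwd a (rsubmx (y : 'rV[R]_(1 + k))).
    exact: (cvg_comp _ (bwd a) (@continuous_rsubmx R 1 1 k y) (cb _ ay)).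
  exact: (cvg_pair c1 c2).
Qed.

Lemma open_overlap a b : is_chart a -> is_chart b -> open (overlap a b).
Proof. by move=> ca [ob _ _ _ _]; exact: open_fwd_image. Qed.

Lemma line_smooth_atlas (A : set (chart R T k)) :
  smooth_atlas A -> smooth_atlas (line_times_atlas A).
Proof.
move=> [chA covA trA]; split.
- by move=> _ [a Aa <-]; exact/line_is_chart/chA.
- by move=> [t x]; have [a Aa ax] := covA x; exists (line_times_chart a) => //; exists a.
- move=> _ _ [a Aa <-] [b Ab <-] r; apply/CrP.
  rewrite line_overlap line_transition; apply: Ck_suspend.
    by apply: open_overlap; exact: chA.
  exact/CrP/trA.
Qed.

Lemma line_manifold (A : set (chart R T k)) :
  manifold A -> manifold (line_times_atlas A).
Proof.
move=> [hT sT aT]; split; last exact: line_smooth_atlas.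
  exact: prod_hausdorff (@Rhausdorff R) hT.
exact: prod_second_countable (real_second_countable R) sT.
Qed.

(** The transitions have Jacobian [diag(1, J)], with the same determinant as [J]. *)
Lemma line_orientation (A O : set (chart R T k)) :
  orientation A O -> orientation (line_times_atlas A) (line_times_atlas O).
Proof.
move=> [sO sAO dO]; split; first exact: line_smooth_atlas.
  by rewrite -image_setU; exact: line_smooth_atlas.
move=> _ _ [a Oa <-] [b Ob <-] y; rewrite line_overlap line_transition => aby.
have [_ _ trO] := sO.
rewrite jacobian_suspend; first by rewrite det_diag1; exact: dO.
by have [dab _] := trO _ _ Oa Ob 1%N; exact: dab.
Qed.

Lemma line_immersed n (A : set (chart R T k)) (f : T -> 'rV[R]_n) :
  immersed_submanifold A f ->
  immersed_submanifold (line_times_atlas A) (line_times f).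
Proof.
move=> [mA sf imf]; have [_ _ [chA _ _]] := mA; split; first exact: line_manifold.
  move=> _ [a Aa <-] r; apply/CrP; rewrite line_cod line_times_bwd.
  by apply: Ck_suspend; [have [] := chA _ Aa|exact/CrP/sf].
move=> _ [a Aa <-] y; rewrite line_cod => ay.
rewrite /coord_frame line_times_bwd jacobian_suspend; last first.
  by have [df _] := sf _ Aa 1%N; exact: df.
exact: row_free_diag1 (imf _ Aa _ ay).
Qed.

(* [calibrated] also quantifies over charts outside [A], where smoothness of [f]
   has to be deduced from that in [A]. *)
Lemma differentiable_oriented_chart n (A O : set (chart R T k))
    (f : T -> 'rV[R]_n) a y :
  smooth_atlas (A `|` O) -> (forall x, exists2 a, A a & dom a x) ->
  smooth_fun A f -> O a -> cod a y -> differentiable (f \o bwd a) y.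
Proof.
move=> [chAO _ trAO] covA sf Oa [x ax <-].
have [b Ab bx] := covA x.
have ca := chAO a (or_intror Oa); have cb := chAO b (or_introl Ab).
have [_ _ aK _ _] := ca; have [_ _ bK _ _] := cb.
have [dt _] := trAO _ _ (or_intror Oa) (or_introl Ab) 1%N.
have [df _] := sf _ Ab 1%N.
have abx : overlap a b (fwd a x) by exists x.
have tE : transition a b (fwd a x) = fwd b x by rewrite /transition/= aK.
have dc : differentiable ((f \o bwd b) \o transition a b) (fwd a x).
  by apply: differentiable_comp; [exact: dt|rewrite tE; apply: df; exists x].
apply: (near_eq_differentiable _ dc).1.
have nU : nbhs (fwd a x) (overlap a b).
  by apply: open_nbhs_nbhs; split=> //; exact: open_overlap.
by apply: filterS nU => _ [z [az bz] <-]; rewrite /transition/= (aK _ az) (bK _ bz).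
Qed.

(** The hypothesis on [eta'] and the calibration of [f] leave only volumes to compare, and the Gram
    determinant of [diag(1, E)] is that of [E]. *)
Lemma line_calibrated n (eta : @Defs.form R k n) (eta' : @Defs.form R k.+1 n.+1)
    (A : set (chart R T k)) (f : T -> 'rV[R]_n) :
  (forall (c : 'M[R]_(1 + k)) (E : 'M[R]_(k, n)),
    eta' (c *m (block_mx 1%:M 0 0 E : 'M[R]_(1 + k, 1 + n))) = \det c * eta E) ->
  calibrated eta A f -> calibrated eta' (line_times_atlas A) (line_times f).
Proof.
move=> etaE [imf [A' oA cal]]; split; first exact: line_immersed.
have [[_ _ [_ covA _]] sf _] := imf; have [_ sAO _] := oA.
exists (line_times_atlas A'); first exact: line_orientation.
move=> _ [a Oa <-] y; rewrite line_cod => ay c.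
have dfa := differentiable_oriented_chart sAO covA sf Oa ay.
(* With [c = 1] the calibration gives the value of [eta] on the frame; a general [c] contributes
   only its determinant. *)
have := cal _ Oa _ ay 1%:M; rewrite mul1mx /volume_form det1 mulr1 => etaV.
rewrite /coord_frame line_times_bwd jacobian_suspend// etaE etaV mulrC.
congr (Num.sqrt _ * _).
by rewrite mulmx_tr_diag1 det_diag1.
Qed.

End LineCharts.

(** * Rulings and framings of the product *)

Section LineRuling.
Context {R : realType}.

Lemma line_affine_plane k n (c : 'rV[R]_n) (E : 'M[R]_(k, n)) :
  affine_plane (oplus 0 c) (block_mx 1%:M 0 0 E : 'M[R]_(1 + k, 1 + n)) =
  (rsubmx : 'rV[R]_(1 + n) -> 'rV[R]_n) @^-1` affine_plane c E.
Proof.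
have mE (t : 'rV[R]_1) (u : 'rV[R]_k) :
    (oplus 0 c : 'rV[R]_(1 + n)) + row_mx t u *m block_mx 1%:M 0 0 E =
    row_mx t (c + u *m E).
  rewrite mul_row_block !mulmx0 mulmx1 addr0 add0r add_row_mx.
  by congr row_mx; apply/matrixP => i j; rewrite !mxE mul0rn add0r.
apply/seteqP; split=> [_ [u _ <-]|y [u _ uy]].
  by exists (rsubmx u) => //; rewrite -{2}[u]hsubmxK mE row_mxKr.
exists (row_mx (lsubmx (y : 'rV[R]_(1 + n))) u : 'rV[R]_(1 + k)) => //.
by rewrite mE uy hsubmxK.
Qed.

(** The homeomorphism from the fibre to its line or plane is multiplied by the identity of the real
    line, and so is its inverse. *)
Lemma line_is_plane_framed_by (T S : topologicalType) k n (f : T -> 'rV[R]_n)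
    (p : T -> S) s (E : 'M[R]_(k, n)) :
  is_plane_framed_by f (p @^-1` [set s]) E ->
  is_plane_framed_by (line_times f) ((p \o snd) @^-1` [set s])
    (block_mx 1%:M 0 0 E : 'M[R]_(1 + k, 1 + n)).
Proof.
move=> [oE [c [[hom inj sur] [g cg gf]]]]; split.
  by rewrite /orthonormal_rows mulmx_tr_diag1 oE -scalar_mx_block.
exists (oplus 0 c); rewrite line_affine_plane; split.
  split.
  - by move=> [t x] /= px; rewrite /preimage/= rsubmx_oplus; exact: hom.
  - move=> [t x] [t' x'] /set_mem/= px /set_mem/= px' ff.
    have tt' : t = t'.
      have := congr1 (fun y : 'rV[R]_(1 + n) => y 0 0) ff.
      by rewrite /line_times /= !oplus00.
    have fx : f x = f x'.
      have := congr1 (fun y : 'rV[R]_(1 + n) => rsubmx y) ff.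
      by rewrite /line_times /= !rsubmx_oplus.
    by rewrite tt' (inj x x')//; exact/mem_set.
  - move=> y /= /sur[x px fx]; exists (y 0 0, x) => //.
    by rewrite /line_times/= fx oplusK.
exists (fun y : 'rV[R]_(1 + n) => (y 0 0, g (rsubmx y))); last first.
  by move=> [t x] /= px; rewrite oplus00 rsubmx_oplus gf.
set L' := rsubmx @^-1` _; apply/subspace_continuousP => y Ly.
have c1 : (fun z : 'rV[R]_(1 + n) => z 0 0) @ within L' (nbhs y) --> y 0 0.
  by apply: cvg_within_filter; exact: coord_continuous.
have c2 : (fun z : 'rV[R]_(1 + n) => g (rsubmx z)) @ within L' (nbhs y) -->
    g (rsubmx (y : 'rV[R]_(1 + n))).
  (* A neighbourhood within [L'] unfolds to the [rsubmx]-preimage of a neighbourhood within the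
     smaller plane. *)
  move=> V nV; have := (subspace_continuousP _ _).1 cg _ Ly V nV.
  exact: (@continuous_rsubmx R 1 1 n y).
exact: (cvg_pair c1 c2).
Qed.

Lemma line_ruling k (T S : topologicalType) d n (A : set (chart R T d))
    (f : T -> 'rV[R]_n) (B : set (chart R S 2)) (p : T -> S) :
  smooth_atlas A -> ruling k A f B p ->
  ruling k.+1 (line_times_atlas A) (line_times f) B (p \o snd).
Proof.
move=> [chA _ _] [mB [cp sp] fibE]; split=> //; last first.
  move=> s; have [E EP] := fibE s.
  exists (block_mx 1%:M 0 0 E : 'M[R]_(1 + k, 1 + n)).
  exact: line_is_plane_framed_by.
have [_ _ [chB _ _]] := mB.
split; first by move=> q; apply: continuous_comp; [exact: cvg_snd|exact: cp].
move=> _ b [a Aa <-] Bb r; apply/CrP.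
have -> : fwd (line_times_chart a) @`
    (dom (line_times_chart a) `&` (p \o snd) @^-1` dom b) =
    (rsubmx : 'rV[R]_(1 + d) -> 'rV[R]_d) @^-1` (fwd a @` (dom a `&` p @^-1` dom b)).
  exact: (line_fwd_image a (dom a `&` p @^-1` dom b)).
apply: (@Ck_comp_rsubmx _ _ _ _ _ (fwd b \o p \o bwd a)); last exact/CrP/sp.
apply: open_fwd_image; first exact: chA.
by apply: open_comp => [x _|]; [exact: cp|have [] := chB _ Bb].
Qed.

(** The frame consists of the constant direction of the line followed by [v], whose smoothness is
    the only nontrivial point. *)
Lemma line_r_framing (T S : topologicalType) n (f : T -> 'rV[R]_n)
    (A : set (chart R T (2 + 1))) (B : set (chart R S 2)) (p : T -> S) v :
  immersed_submanifold A f -> manifold B -> submersion A B p ->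
  r_orientation f p v ->
  r_framing (line_times f) B (p \o snd)
    (fun s => block_mx 1%:M 0 0 (v s) : 'M[R]_(1 + 1, 1 + n)).
Proof.
move=> imf mB subp ov; have sv := continuous_direction_smooth imf mB subp ov.
have [_ _ [chB _ _]] := mB.
split=> [i b Bb r|s]; last first.
  by apply: line_is_plane_framed_by; have [_] := ov; exact.
apply/CrP; have [_ ob _ _ _] := chB _ Bb.
have [i0|i1] := eqVneq i ord0.
  have -> : (fun s => row i (block_mx 1%:M 0 0 (v s) : 'M[R]_(1 + 1, 1 + n))) \o bwd b =
      fun=> row_mx 1%:M 0.
    apply/funext => u /=.
    have -> : i = lshift 1 (0 : 'I_1) by rewrite i0; exact/val_inj.
    exact: etrans (rowKu _ _ _) (row_id _ _).
  exact: Ck_cst.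
have -> : (fun s => row i (block_mx 1%:M 0 0 (v s) : 'M[R]_(1 + 1, 1 + n))) \o bwd b =
    fun u => (v \o bwd b) u *m row_mx 0 1%:M.
  apply/funext => u /=.
  have -> : i = rshift 1 (0 : 'I_1).
    by apply/val_inj; move: i1; case: i => -[|[|]].
  rewrite mul_mx_row mulmx0 mulmx1.
  exact: etrans (rowKd _ _ _) (row_id _ _).
apply: Ck_mulmxr => //; exact/CrP/sv.
Qed.

End LineRuling.

(** * The calibration forms on block frames *)

Section Forms.
Context {R : realType}.

Lemma dx_mulmx k n (I : k.-tuple nat) (c : 'M[R]_k) (E : 'M[R]_(k, n.+1)) :
  dx I (c *m E) = \det c * dx I E.
Proof.
rewrite /dx -det_mulmx; congr (\det _); apply/matrixP => a b; rewrite !mxE.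
by apply: eq_bigr => i _; rewrite mxE.
Qed.

Lemma diag1_00 k n (E : 'M[R]_(k, n)) (i : 'I_(1 + k)) (j : 'I_(1 + n)) :
  i = 0 :> nat -> j = 0 :> nat ->
  (block_mx 1%:M 0 0 E : 'M[R]_(1 + k, 1 + n)) i j = 1.
Proof.
move=> i0 j0; have -> : i = lshift k 0 by exact/val_inj.
have -> : j = lshift n 0 by exact/val_inj.
by rewrite block_mxEul mxE.
Qed.

Lemma diag1_0S k n (E : 'M[R]_(k, n)) (i : 'I_(1 + k)) (j : 'I_(1 + n)) :
  i = 0 :> nat -> (0 < j)%N ->
  (block_mx 1%:M 0 0 E : 'M[R]_(1 + k, 1 + n)) i j = 0.
Proof.
move=> i0 j0; have -> : i = lshift k 0 by exact/val_inj.
have [j' jj'|j' jj'] := splitP j; first by move: j0; rewrite jj' ord1.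
have -> : j = rshift 1 j' by exact/val_inj.
by rewrite block_mxEur mxE.
Qed.

Lemma diag1_SS k n (E : 'M[R]_(k, n)) (i : 'I_(1 + k)) (j : 'I_(1 + n))
    (i' : 'I_k) (j' : 'I_n) :
  i = i'.+1 :> nat -> j = j'.+1 :> nat ->
  (block_mx 1%:M 0 0 E : 'M[R]_(1 + k, 1 + n)) i j = E i' j'.
Proof.
move=> ii' jj'; have -> : i = rshift 1 i' by exact/val_inj.
have -> : j = rshift 1 j' by exact/val_inj.
by rewrite block_mxEdr.
Qed.

(** The first row of the block matrix vanishes in all selected columns. The upper bound matters:
    [inord] sends an index out of range to column 0, where the entry is 1. *)
Lemma dx_diag1_eq0 k n (I : k.+1.-tuple nat) (E : 'M[R]_(k, n.+1)) :
  all (fun i => 1 < i <= n.+2)%N I ->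
  dx I (block_mx 1%:M 0 0 E : 'M[R]_(1 + k, 1 + n.+1)) = 0.
Proof.
move=> /allP I1; rewrite /dx (expand_det_row _ ord0) big1// => b _; rewrite mxE.
have /I1/andP[bl br] := mem_tnth b I.
rewrite diag1_0S ?mul0r// inordK; first by case: (tnth I b) bl => [|[]].
by case: (tnth I b) bl br => [|[]].
Qed.

(** Expansion along the first row leaves only the first term; its minor is [dx J] because deleting
    the line coordinate lowers every index by one. *)
Lemma dx_diag1 k n (I : k.+1.-tuple nat) (J : k.-tuple nat) (E : 'M[R]_(k, n.+1)) :
  tval I = 1%N :: [seq j.+1 | j <- J] -> all (fun j => 0 < j <= n.+1)%N J ->
  dx I (block_mx 1%:M 0 0 E : 'M[R]_(1 + k, 1 + n.+1)) = dx J E.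
Proof.
move=> IJ /allP J1.
have I0 : tnth I ord0 = 1%N by rewrite (tnth_nth 0%N) IJ.
have IS b : tnth I (lift ord0 b) = (tnth J b).+1.
  by rewrite !(tnth_nth 0%N) IJ/= add0n (nth_map 0%N)// size_tuple ltn_ord.
rewrite /dx (expand_det_row _ ord0) big_ord_recl big1 ?addr0; last first.
  move=> b _; have /J1/andP[bl br] := mem_tnth b J.
  by rewrite mxE IS diag1_0S ?mul0r// inordK.
rewrite mxE I0 diag1_00 ?inordK// mul1r /cofactor /= expr0 mul1r.
congr (\det _); apply/matrixP => a b.
do 3 rewrite [LHS]mxE; rewrite [RHS]mxE IS.
have /J1/andP[bl br] := mem_tnth b J.
by apply: (@diag1_SS k n.+1 E) => //=; rewrite !inordK ?prednK.
Qed.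

(** The seven monomials containing index 1 give the seven terms of the associative form, and the
    other seven vanish. *)
Lemma Cayley_form_diag1 (c : 'M[R]_(1 + 3)) (E : 'M[R]_(3, 7)) :
  Cayley_form (c *m (block_mx 1%:M 0 0 E : 'M[R]_(1 + 3, 1 + 7))) =
  \det c * associative_form E.
Proof.
rewrite /Cayley_form /associative_form /dx4 /dx3 !dx_mulmx.
rewrite (@dx_diag1 3 6 [tuple 1; 2; 3; 4]%N [tuple 1; 2; 3]%N)//.
rewrite (@dx_diag1 3 6 [tuple 1; 2; 5; 6]%N [tuple 1; 4; 5]%N)//.
rewrite (@dx_diag1 3 6 [tuple 1; 2; 7; 8]%N [tuple 1; 6; 7]%N)//.
rewrite (@dx_diag1 3 6 [tuple 1; 3; 5; 7]%N [tuple 2; 4; 6]%N)//.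
rewrite (@dx_diag1 3 6 [tuple 1; 3; 6; 8]%N [tuple 2; 5; 7]%N)//.
rewrite (@dx_diag1 3 6 [tuple 1; 4; 5; 8]%N [tuple 3; 4; 7]%N)//.
rewrite (@dx_diag1 3 6 [tuple 1; 4; 6; 7]%N [tuple 3; 5; 6]%N)//.
do 7 rewrite dx_diag1_eq0//.
ring.
Qed.

Lemma det3E (F : comRingType) (M : 'M[F]_3) :
  let i : 'I_3 := inord 0 in let j : 'I_3 := inord 1 in let k : 'I_3 := inord 2 in
  \det M = M i i * (M j j * M k k - M j k * M k j)
    - M i j * (M j i * M k k - M j k * M k i)
    + M i k * (M j i * M k j - M j j * M k i).
Proof.
(* Entries indexed by natural numbers depend only on the values of the ordinals, however these are
   built from [lift]. *)
pose m i j := M (inord i) (inord j) : F.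
have mE i j : M i j = m (val i) (val j) by rewrite /m !inord_val.
rewrite /= (expand_det_row _ ord0) !big_ord_recl big_ord0 /cofactor.
have det2E (N : 'M[F]_2) :
    \det N = N ord0 ord0 * N ord_max ord_max - N ord0 ord_max * N ord_max ord0.
  have l0 : lift ord0 ord0 = ord_max :> 'I_2 by exact/val_inj.
  have l1 : lift ord_max ord0 = ord0 :> 'I_2 by exact/val_inj.
  rewrite (expand_det_row _ ord0) !big_ord_recl big_ord0 /cofactor !det_mx11 !mxE.
  by rewrite !l0 l1 /=; ring.
rewrite !det2E !mxE !mE /= !inordK//= /bump /=; ring.
Qed.

(** The surviving terms are [dx_246 - dx_235 - dx_145 - dx_136], which is [- Im Omega]; at
    [- pi / 2] the cosine is 0 and the sine is -1. *)
Lemma coassociative_form_diag1 (c : 'M[R]_(1 + 3)) (E : 'M[R]_(3, 6)) :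
  coassociative_form (c *m (block_mx 1%:M 0 0 E : 'M[R]_(1 + 3, 1 + 6))) =
  \det c * special_Lagrangian_form (- (pi / 2)) E.
Proof.
rewrite /coassociative_form /dx4 !dx_mulmx.
rewrite (@dx_diag1 3 5 [tuple 1; 3; 5; 7]%N [tuple 2; 4; 6]%N)//.
rewrite (@dx_diag1 3 5 [tuple 1; 3; 4; 6]%N [tuple 2; 3; 5]%N)//.
rewrite (@dx_diag1 3 5 [tuple 1; 2; 5; 6]%N [tuple 1; 4; 5]%N)//.
rewrite (@dx_diag1 3 5 [tuple 1; 2; 4; 7]%N [tuple 1; 3; 6]%N)//.
do 3 rewrite dx_diag1_eq0//.
rewrite !mulr0 !add0r -!mulrBr; congr (_ * _).
rewrite /special_Lagrangian_form cosN sinN cos_pihalf sin_pihalf mul0r add0r mulN1r.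
rewrite /dx /Omega !det3E !mxE /dz !mxE !(tnth_nth 0%N) /= !inordK//=.
(* The doubled indices from [dz] become numerals, so that [ring] sees the same entries of [E] on
   both sides. *)
rewrite -[0.*2]/0%N -[1.*2]/2%N -[2.*2]/4%N; ring.
Qed.

End Forms.

Theorem theorem5p3 (R : realType) :
  (forall (N S : topologicalType)
      (A : set (chart R N 3)) (B : set (chart R S 2))
      (f : N -> 'rV[R]_7) (p : N -> S),
    associative_fold A f -> ruling 1 A f B p ->
    [/\ Cayley_fold (line_times_atlas A) (line_times f),
        ruling 2 (line_times_atlas A) (line_times f) B (p \o snd) &
        submersion A B p -> (exists v, r_orientation f p v) ->
        exists E, r_framing (line_times f) B (p \o snd) E]) /\
  (forall (L S : topologicalType)
      (A : set (chart R L 3)) (B : set (chart R S 2))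
      (f : L -> 'rV[R]_6) (p : L -> S),
    special_Lagrangian_fold (- (pi / 2)) A f -> ruling 1 A f B p ->
    [/\ coassociative_fold (line_times_atlas A) (line_times f),
        ruling 2 (line_times_atlas A) (line_times f) B (p \o snd) &
        submersion A B p -> (exists v, r_orientation f p v) ->
        exists E, r_framing (line_times f) B (p \o snd) E]).
Proof.
(* The two halves run alike; they differ only in the reduction of the form on block frames. *)
split=> N S A B f p cal rul; have [imf _] := cal; have [[_ _ sA] _ _] := imf;
  have [mB _ _] := rul; split.
- exact: line_calibrated Cayley_form_diag1 cal.
- exact: line_ruling.
- by move=> subp [v ov]; exact: ex_intro (line_r_framing imf mB subp ov).
- exact: line_calibrated coassociative_form_diag1 cal.
- exact: line_ruling.
- by move=> subp [v ov]; exact: ex_intro (line_r_framing imf mB subp ov).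
Qed.
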